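(* Let $r\geq 2$ and $h\geq 1$ be integers, let $k\ge 1$ and $\delta\ge 1$ be integers, and let $n\geq k+r(h+1)$. Let $G$ be a graph on $n$ vertices with $\kappa^h_r(G)=k$ and minimum degree $\delta(G)=\delta$, i.e. $G\in\mathcal{G}_{n,\delta}^{\kappa_r^h}$ with $\kappa^h_r=k$. Then $$\rho(G)\leq \rho\big(G^{k,\delta}_n\big),$$ with equality if and only if $G\cong G^{k,\delta}_n$.
   Context: All graphs are finite and simple; $\rho(G)$ denotes the spectral radius (largest eigenvalue) of the adjacency matrix of $G$. $K_m$ is the complete graph on $m$ vertices, $\vee$ denotes the join and $\cup$ the disjoint union of graphs, and $sK_m$ denotes $s$ disjoint copies of $K_m$. For integers $r\ge 2$, $h\ge 0$, the $h$-extra $r$-component connectivity $\kappa^h_r(G)$ of a graph $G$ is the minimum size of a vertex subset $S\subseteq V(G)$ such that $G-S$ is disconnected, has at least $r$ connected components, and every component of $G-S$ has at least $h+1$ vertices. $\mathcal{G}_{n,\delta}^{\kappa_r^h}$ denotes the set of graphs on $n$ vertices with $h$-extra $r$-component connectivity $\kappa^h_r$ and minimum degree $\delta$. The graph $G^{k,\delta}_n$ (with $k=\kappa^h_r$) is defined as follows. (i) If $\delta\le k$: take $K_{k}\vee\big(K_{n-k-(r-1)(h+1)}\cup (r-2)K_{h+1}\cup K_h\big)$ together with one further isolated vertex $w$ (i.e. the graph $K_k\vee(K_{n-k-(r-1)(h+1)}\cup (r-2)K_{h+1}\cup K_h)\cup K_1$); add $\delta-1$ edges joining $w$ to $\delta-1$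 vertices of the $K_k$, and then add one edge joining $w$ to a vertex of the $K_h$. (ii) If $k+1\le \delta< k+h$: take $K_{k}\vee\big(K_{n-k-(r-1)(h+1)}\cup (r-2)K_{h+1}\cup K_h\cup K_1\big)$ and add $\delta-k$ edges joining the vertex of the $K_1$ to $\delta-k$ vertices of the $K_h$. (iii) If $\delta\ge k+h$: $G^{k,\delta}_n= K_{k}\vee\big(K_{n-k-(r-1)(\delta-k+1)}\cup (r-1)K_{\delta-k+1}\big)$. *)

(* Defs.v *)
From HB Require Import structures.
From mathcomp Require Import all_boot all_order all_algebra.
From mathcomp Require Import reals.
Set Implicit Arguments. Unset Strict Implicit. Unset Printing Implicit Defensive.
Import Order.TTheory GRing.Theory Num.Theory.

Definition simple_graph (n : nat) (G : rel 'I_n) : Prop :=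
  symmetric G /\ irreflexive G.

Definition adjmx (R : realType) (n : nat) (G : rel 'I_n) : 'M[R]_n :=
  (\matrix_(i, j) (G i j)%:R)%R.

Definition is_spectral_radius (R : realType) (n : nat) (A : 'M[R]_n) (rho : R)
  : Prop :=
  eigenvalue A rho /\ forall mu : R, eigenvalue A mu -> (mu <= rho)%R.

Definition deg (n : nat) (G : rel 'I_n) (v : 'I_n) : nat := #|[set u | G v u]|.

Definition min_degree_is (n : nat) (G : rel 'I_n) (d : nat) : Prop :=
  (exists v, deg G v = d) /\ forall v, d <= deg G v.

Definition del_rel (n : nat) (G : rel 'I_n) (S : {set 'I_n}) : rel 'I_n :=
  fun x y => [&& x \notin S, y \notin S & G x y].

Definition components (n : nat) (G : rel 'I_n) (S : {set 'I_n})
  : {set {set 'I_n}} :=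
  [set [set y | connect (del_rel G S) x y] | x in ~: S].

Definition hr_cut (n : nat) (G : rel 'I_n) (r h : nat) (S : {set 'I_n}) : Prop :=
  1 < #|components G S| /\ r <= #|components G S| /\
  forall C, C \in components G S -> h.+1 <= #|C|.

Definition kappa_hr_is (n : nat) (G : rel 'I_n) (r h k : nat) : Prop :=
  (exists S, hr_cut G r h S /\ #|S| = k) /\
  forall S, hr_cut G r h S -> k <= #|S|.

Definition isomorphic (n : nat) (G H : rel 'I_n) : Prop :=
  exists f : 'I_n -> 'I_n, bijective f /\ forall x y, G x y = H (f x) (f y).

(* Vertex layout (as natural numbers < n):
   [0, k)                 : the clique K_k (joined to everything below)
   cases (i),(ii), with a := n - k - (r-1)(h+1):
     [k, k+a)             : K_a                         (block 0)
     next (r-2) runs of h+1 vertices : copies of K_{h+1} (blocks 1..r-2)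
     next h vertices      : K_h                         (block r-1)
     n-1                  : the extra vertex w
   case (iii), with s := delta-k+1 and b := n - k - (r-1)s:
     [k, k+b)             : K_b                         (block 0)
     next (r-1) runs of s vertices : copies of K_s      (blocks 1..r-1) *)

Definition blk (start size v : nat) : nat :=
  if v < start then 0 else (v - start) %/ size + 1.

Definition Gext (n k r h delta : nat) : rel 'I_n :=
  fun x y =>
  let u := val x in let v := val y in
  if k + h <= delta then
    let s := delta - k + 1 in
    let b := n - k - (r - 1) * s in
    (u != v) && [|| u < k, v < k | blk (k + b) s u == blk (k + b) s v]
  else
    let a := n - k - (r - 1) * h.+1 in
    let w := n.-1 in
    let kh0 := k + a + (r - 2) * h.+1 in  (* first vertex of K_h *)
    let wadj z :=
      if delta <= k then (z < delta - 1) || (z == kh0)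
      else (z < k) || ((kh0 <= z) && (z < kh0 + (delta - k)))
    in
    (u != v) &&
    (if u == w then wadj v
     else if v == w then wadj u
     else [|| u < k, v < k | blk (k + a) h.+1 u == blk (k + a) h.+1 v]).

Arguments Gext : clear implicits.
Arguments adjmx R {n} G.

(* Main.v *)
(** The proof compares Rayleigh quotients. With [H = max h (delta - k)], every
    component left by a [k]-cut of [G] has more than [H] vertices and
    [delta <= k + H], so that the three cases in the definition of the extremal
    graph become one. Completing all adjacencies except those of a vertex [v] of
    degree [delta], [G] becomes a subgraph of a graph given by a labelling of the
    vertices (cut, or one of [r] blocks) and the neighbourhood of [v].
    If [v] lies in the cut, it is exchanged with a vertex of a block, which
    strictly increases the spectral radius. Among the graphs where [v] lies in a
    block and has a neighbour there, take one of maximal spectral radius, with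
    Perron vector [x]. Exchanging two vertices or moving one of them to another
    block changes [x^T A x] by an explicit amount, and maximality forces
    [min (delta - 1) k] neighbours of [v] to be in the cut, the block of [v] to
    have [H + 1] vertices, and at most one block to be larger. These conditions
    determine the graph up to isomorphism, and the extremal graph satisfies them. *)
Require Import Defs.
From HB Require Import structures.
From mathcomp Require Import boolp classical_sets reals topology normedtype derive.
From mathcomp Require Import all_boot all_order all_algebra perm.
From mathcomp Require Import ring lra zify.
Set Implicit Arguments. Unset Strict Implicit. Unset Printing Implicit Defensive.
Import Order.TTheory GRing.Theory Num.Theory.
Import numFieldNormedType.Exports.

(** * Spectral radius and Rayleigh quotients *)

Section Quadratic.
Local Open Scope ring_scope.
Variables (R : realType) (n : nat).
Implicit Types (G H : rel 'I_n) (x y : 'I_n -> R).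

Definition nbsum G x i : R := \sum_(j | G i j) x j.
Definition quad G x : R := \sum_i x i * nbsum G x i.
Definition sqnorm x : R := \sum_i x i ^+ 2.

(** The largest eigenvalue in variational form: [rho] bounds the Rayleigh quotient and is attained
    by an eigenvector. *)
Definition is_top G (rho : R) : Prop :=
  (forall x, quad G x <= rho * sqnorm x) /\
  exists x, sqnorm x != 0 /\ forall i, nbsum G x i = rho * x i.

Lemma sqnorm_ge0 x : 0 <= sqnorm x.
Proof. by apply: sumr_ge0 => i _; exact: sqr_ge0. Qed.

Lemma sqnorm_eq0 x : sqnorm x = 0 -> forall i, x i = 0.
Proof.
move=> /eqP; rewrite psumr_eq0; last by move=> i _; exact: sqr_ge0.
by move=> /allP H i; move: (H i); rewrite mem_index_enum sqrf_eq0 => /(_ isT)/eqP.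
Qed.

Lemma quad_eigen G x rho :
  (forall i, nbsum G x i = rho * x i) -> quad G x = rho * sqnorm x.
Proof.
by move=> E; rewrite mulr_sumr; apply: eq_bigr => i _; rewrite E expr2; ring.
Qed.

Lemma nbsumD G x y t i :
  nbsum G (fun j => x j + t * y j) i = nbsum G x i + t * nbsum G y i.
Proof. by rewrite /nbsum big_split mulr_sumr. Qed.

Lemma nbsumC G x y : symmetric G ->
  \sum_i x i * nbsum G y i = \sum_i y i * nbsum G x i.
Proof.
move=> sG; rewrite /nbsum.
under eq_bigr do rewrite mulr_sumr.
under [RHS]eq_bigr do rewrite mulr_sumr.
rewrite (exchange_big_dep xpredT) //=.
apply: eq_bigr => j _; under eq_bigl do rewrite sG.
by apply: eq_bigr => i _; rewrite mulrC.
Qed.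

(** With [e] the residual of the eigenvalue equation at [x], the gap [M * sqnorm - quad] along
    [x + t * e] is a nonnegative polynomial in [t] without constant term and with linear coefficient
    [-2 * sqnorm e]; hence [e] vanishes. *)
Lemma quad_attained G x M : symmetric G ->
    (forall y, quad G y <= M * sqnorm y) -> quad G x = M * sqnorm x ->
  forall i, nbsum G x i = M * x i.
Proof.
move=> sG leM eqM.
pose e i := nbsum G x i - M * x i.
suff e0 : sqnorm e = 0 by move=> i; apply/eqP; rewrite -subr_eq0; apply/eqP/(sqnorm_eq0 e0).
pose c := M * sqnorm e - quad G e.
have c0 : 0 <= c by rewrite subr_ge0.
have key t : 0 <= - 2 * t * sqnorm e + t ^+ 2 * c.
  have := leM (fun j => x j + t * e j); rewrite -subr_ge0.
  suff -> : M * sqnorm (fun j => x j + t * e j) - quad G (fun j => x j + t * e j)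
    = - 2 * t * sqnorm e + t ^+ 2 * c by [].
  have -> : sqnorm (fun j => x j + t * e j) =
      sqnorm x + 2 * t * (\sum_i e i * x i) + t ^+ 2 * sqnorm e.
    rewrite /sqnorm !mulr_sumr -!big_split /=; apply: eq_bigr => i _; ring.
  have -> : quad G (fun j => x j + t * e j) =
      quad G x + 2 * t * (\sum_i e i * nbsum G x i) + t ^+ 2 * quad G e.
    transitivity (quad G x + t * (\sum_i e i * nbsum G x i)
       + t * (\sum_i x i * nbsum G e i) + t ^+ 2 * quad G e).
      rewrite /quad !mulr_sumr -!big_split /=; apply: eq_bigr => i _.
      rewrite nbsumD; ring.
    rewrite (nbsumC _ _ sG); ring.
  have -> : sqnorm e = \sum_i e i * nbsum G x i - M * (\sum_i e i * x i).
    rewrite mulr_sumr -sumrB; apply: eq_bigr => i _; rewrite /e; ring.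
  rewrite /c eqM; set s := sqnorm e.
  have -> : s = \sum_i e i * nbsum G x i - M * (\sum_i e i * x i).
    rewrite mulr_sumr -sumrB; apply: eq_bigr => i _; rewrite /e; ring.
  ring.
have := sqnorm_ge0 e; rewrite le_eqVlt => /orP[/eqP<-//|s0].
have c1 : 0 < c + 1 by apply: ltr_wpDl.
(* The polynomial has its minimum at [sqnorm e / c]; the denominator [c + 1] also covers [c = 0]. *)
have := key (sqnorm e / (c + 1)).
have -> : - 2 * (sqnorm e / (c + 1)) * sqnorm e + (sqnorm e / (c + 1)) ^+ 2 * c
  = - (sqnorm e / (c + 1)) ^+ 2 * (c + 2) by field; rewrite gt_eqF.
have : 0 < (sqnorm e / (c + 1)) ^+ 2 * (c + 2).
  by apply: mulr_gt0; [apply/exprn_gt0/divr_gt0|apply: ltr_wpDl].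
by lra.
Qed.

Lemma is_top_uniq G rho1 rho2 : is_top G rho1 -> is_top G rho2 -> rho1 = rho2.
Proof.
have W r1 r2 : is_top G r1 -> is_top G r2 -> r1 <= r2.
  move=> [_ [x [x0 /quad_eigen E]]] [/(_ x)]; rewrite E ler_pM2r //.
  by rewrite lt_def x0 sqnorm_ge0.
by move=> t1 t2; apply/eqP; rewrite eq_le !W.
Qed.

Lemma sqnormZ a x : sqnorm (fun i => a * x i) = a ^+ 2 * sqnorm x.
Proof. by rewrite mulr_sumr; apply: eq_bigr => i _; rewrite exprMn. Qed.

Lemma quadZ G a x : quad G (fun i => a * x i) = a ^+ 2 * quad G x.
Proof.
rewrite mulr_sumr; apply: eq_bigr => i _; rewrite /nbsum -mulr_sumr; ring.
Qed.

Lemma continuous_sum_mx (I : Type) (r : seq I) (P : pred I)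
    (f : I -> 'rV[R]_n -> R) :
  (forall i, continuous (f i)) -> continuous (fun v => \sum_(i <- r | P i) f i v).
Proof.
move=> cf; elim: r => [|i r IH].
  have -> : (fun v => \sum_(i <- [::] | P i) f i v) = (fun=> 0).
    by apply/funext => v; rewrite big_nil.
  exact: cst_continuous.
have -> : (fun v => \sum_(j <- i :: r | P j) f j v) = if P i then
    (fun v => f i v + \sum_(j <- r | P j) f j v) else fun v => \sum_(j <- r | P j) f j v.
  by case E: (P i); apply/funext => v; rewrite big_cons E.
by case: (P i) => // v; apply: (cvgD (cf i v) (IH v)).
Qed.

(** The form is continuous on the compact unit sphere, so it has a maximum there, and
    [quad_attained] makes the maximizer an eigenvector. *)
Lemma is_top_exists G : (0 < n)%N -> symmetric G -> exists rho, is_top G rho.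
Proof.
move=> n0 sG.
pose fn (v : 'rV[R]_n) i := v ord0 i.
pose A := [set v : 'rV[R]_n | sqnorm (fn v) = 1]%classic.
have cc i : continuous (fun v => fn v i) by exact: coord_continuous.
have cN : continuous (fun v => sqnorm (fn v)).
  by apply: continuous_sum_mx => i v; exact: (cvgM (cc i v) (cc i v)).
have cQ : continuous (fun v => quad G (fn v)).
  apply: continuous_sum_mx => i v; apply: (cvgM (cc i v)).
  exact: continuous_sum_mx.
have A0 : (A !=set0)%classic.
  exists (delta_mx ord0 (Ordinal n0)); rewrite /A /= /sqnorm (bigD1 (Ordinal n0)) //=.
  rewrite /fn mxE !eqxx big1 ?addr0 ?expr1n // => j /negbTE H.
  by rewrite mxE H andbF expr0n.
have cA : compact A.
  apply: bounded_closed_compact.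
    exists 1; split; first exact: num_real.
    move=> M M1 v /= v1; rewrite /Num.norm /= mx_normrE.
    apply: bigmax_le => [|[i j] _ /=]; first by apply: ltW; apply: lt_trans M1.
    apply: le_trans (ltW M1); rewrite -(@ler_pXn2r _ 2) ?nnegrE //.
    rewrite expr1n -normrX ger0_norm ?sqr_ge0 // -v1 /sqnorm (bigD1 j) //=.
    rewrite ord1 /fn lerDl; apply: sumr_ge0 => k _; exact: sqr_ge0.
  have -> : A = ((fun v => sqnorm (fn v)) @^-1` [set 1])%classic by [].
  apply: closed_comp => [v _|]; [exact: cN|exact: closed_eq].
have [v vA vmax] := EVT_max_rV A0 cA (continuous_subspaceT cQ).
have v1 : sqnorm (fn v) = 1 by move: vA; rewrite in_setE.
have leM y : quad G y <= quad G (fn v) * sqnorm y.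
  have := sqnorm_ge0 y; rewrite le_eqVlt => /orP[/eqP y0|y0].
    rewrite -y0 mulr0 /quad big1 // => i _.
    by rewrite (sqnorm_eq0 (esym y0)) mul0r.
  pose a := (Num.sqrt (sqnorm y))^-1.
  have a2 : a ^+ 2 = (sqnorm y)^-1 by rewrite exprVn sqr_sqrtr // ltW.
  pose w : 'rV[R]_n := \row_i (a * y i).
  have fw : fn w = fun i => a * y i by apply/funext => i; rewrite /fn mxE.
  have := vmax w; rewrite fw quadZ a2 mulrC ler_pdivrMr //; apply.
  by rewrite in_setE /A /= fw sqnormZ a2 mulVf // gt_eqF.
exists (quad G (fn v)); split=> //; exists (fn v); rewrite v1 oner_eq0; split=> //.
by apply: quad_attained => //; rewrite v1 mulr1.
Qed.

(** [eigenvalue] refers to row vectors multiplied on the left; symmetry turns the resulting column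
    sums into neighbour sums. *)
Lemma eigenvalue_nbsum G (a : R) : symmetric G ->
  eigenvalue (adjmx R G) a <->
  exists x, sqnorm x != 0 /\ forall i, nbsum G x i = a * x i.
Proof.
move=> sG; split.
  move=> /eigenvalueP[v vA v0]; exists (fun i => v ord0 i); split.
    apply: contraNneq v0 => /sqnorm_eq0 v0; apply/eqP/rowP => i; rewrite mxE; exact: v0.
  move=> i; move/rowP/(_ i): vA; rewrite !mxE => <-.
  rewrite /nbsum big_mkcond; apply: eq_bigr => j _; rewrite mxE sG.
  by case: (G j i); rewrite ?mulr1 ?mulr0.
move=> [x [x0 E]]; apply/eigenvalueP; exists (\row_i x i).
  apply/rowP => i; rewrite !mxE -E /nbsum [RHS]big_mkcond; apply: eq_bigr => j _.
  by rewrite !mxE sG; case: (G i j); rewrite ?mulr1 ?mulr0.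
apply: contraNneq x0 => /rowP x0; rewrite /sqnorm big1 // => i _.
by move: (x0 i); rewrite !mxE => ->; rewrite expr0n.
Qed.

Lemma spectral_radius_top G rho : (0 < n)%N -> symmetric G ->
  is_spectral_radius (adjmx R G) rho -> is_top G rho.
Proof.
move=> n0 sG [/(eigenvalue_nbsum _ sG) [x [x0 E]] rmax].
have [M [leM Mx]] := is_top_exists n0 sG.
have -> : rho = M; last by split.
apply/eqP; rewrite eq_le rmax ?andbT; last by apply/eigenvalue_nbsum.
by move: (leM x); rewrite (quad_eigen E) ler_pM2r // lt_def x0 sqnorm_ge0.
Qed.

(** Taking absolute values of the entries keeps the norm and does not decrease the form, so the
    maximum is still attained. *)
Lemma is_top_nonneg G rho : symmetric G -> is_top G rho ->
  exists x, [/\ forall i, 0 <= x i, 0 < sqnorm x & forall i, nbsum G x i = rho * x i].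
Proof.
move=> sG [leM [x [x0 E]]]; exists (fun i => `|x i|).
have N : sqnorm (fun i => `|x i|) = sqnorm x.
  by apply: eq_bigr => i _; rewrite real_normK // num_real.
split=> //; first by rewrite N lt_def x0 sqnorm_ge0.
apply: quad_attained => //; apply/eqP; rewrite eq_le leM N -(quad_eigen E) /=.
apply: ler_sum => i _; apply: le_trans (ler_norm _) _; rewrite normrM.
by apply: ler_wpM2l => //; exact: ler_norm_sum.
Qed.

(** A zero entry makes a sum of nonnegative neighbour entries vanish, so zeros spread along
    paths. *)
Lemma nonneg_eigen_gt0 G rho x : (forall i j, connect G i j) ->
    (forall i, 0 <= x i) -> 0 < sqnorm x ->
    (forall i, nbsum G x i = rho * x i) ->
  forall i, 0 < x i.
Proof.
move=> cG x0 xn E i; rewrite lt_def x0 andbT; apply/eqP => xi0.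
have W j p : x j = 0 -> path G j p -> x (last j p) = 0.
  elim: p j => //= k p IH j xj /andP[jk]; apply: IH.
  move: (E j); rewrite xj mulr0 /nbsum => /eqP; rewrite psumr_eq0 //.
  by move=> /allP /(_ k); rewrite mem_index_enum jk => /(_ isT)/eqP.
move: xn; rewrite /sqnorm big1 ?ltxx // => j _.
by have /connectP[p pp ->] := cG i j; rewrite W // expr0n.
Qed.

(** An eigenvector of [G] serves as test vector for [H]. If the two values agree, it attains the
    maximum for [H] as well, so it is an eigenvector of both graphs, and connectedness of [H] makes
    it positive. *)
Lemma top_step G H rho rho' x : symmetric H -> (forall i j, connect H i j) ->
    is_top H rho' -> (forall i, 0 <= x i) -> 0 < sqnorm x ->
    (forall i, nbsum G x i = rho * x i) -> quad G x <= quad H x ->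
  rho <= rho' /\ (rho = rho' ->
    [/\ forall i, 0 < x i, forall i, nbsum H x i = nbsum G x i & quad H x = quad G x]).
Proof.
move=> sH cH [leM _] x0 xn E le.
have le' : rho * sqnorm x <= rho' * sqnorm x.
  by rewrite -(quad_eigen E); apply: le_trans le _.
split; first by move: le'; rewrite ler_pM2r.
move=> Er; have Eq : quad H x = rho' * sqnorm x.
  by apply/eqP; rewrite eq_le leM -Er -(quad_eigen E).
have EH := quad_attained sH leM Eq.
split; last by rewrite Eq -Er (quad_eigen E).
  by apply: nonneg_eigen_gt0 EH.
by move=> i; rewrite EH E Er.
Qed.

Lemma quad_sub G H x : (forall i, 0 <= x i) -> (forall i j, G i j -> H i j) ->
  quad G x <= quad H x.
Proof.
move=> x0 GH; apply: ler_sum => i _; apply: ler_wpM2l => //.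
rewrite /nbsum big_mkcond [leRHS]big_mkcond; apply: ler_sum => j _.
by case: ifP => [/GH ->//|_]; case: ifP.
Qed.

Lemma nbsum_sub_eq G H x i : (forall i, 0 < x i) -> (forall i j, G i j -> H i j) ->
  nbsum H x i = nbsum G x i -> forall j, G i j = H i j.
Proof.
move=> x0 GH E j; apply/idP/idP; first exact: GH.
apply: contraTT => nG; apply/negP => Hij; move: E; apply/eqP.
rewrite gt_eqF // /nbsum big_mkcond [ltRHS]big_mkcond.
rewrite (bigD1 j) // [ltRHS](bigD1 j) //= (negbTE nG) Hij.
apply: ltr_leD => //; apply: ler_sum => k _.
by case: ifP => [/GH ->//|_]; case: ifP => // _; exact: ltW.
Qed.

(** The edges at [u] contribute [2 * x u * nbsum] at [u], and the rest of the form is common to both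
    graphs. The formulas for relabelling and for changing [N] follow from this identity. *)
Lemma quad_change G H x u : symmetric G -> symmetric H ->
    ~~ G u u -> ~~ H u u ->
    (forall i j, i != u -> j != u -> G i j = H i j) ->
  quad H x = quad G x + 2 * x u * (nbsum H x u - nbsum G x u).
Proof.
move=> sG sH Gu Hu agree.
have split_ K : symmetric K -> ~~ K u u -> quad K x =
    2 * x u * nbsum K x u + \sum_(i | i != u) x i * \sum_(j | (j != u) && K i j) x j.
  move=> sK Ku; rewrite /quad (bigD1 u) //=.
  have -> : \sum_(i | i != u) x i * nbsum K x i =
      \sum_(i | i != u) (x u * (if K u i then x i else 0)) +
      \sum_(i | i != u) x i * \sum_(j | (j != u) && K i j) x j.
    rewrite -big_split; apply: eq_bigr => i iu /=.
    rewrite /nbsum (bigID (fun j => j == u)) /= mulrDr; congr (_ + _ * _).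
      rewrite (eq_bigl (fun j => (j == u) && K u i)); last first.
        by move=> j; case: eqP => [->|]; rewrite ?andbF // sK andbT.
      by rewrite big_mkcondr big_pred1_eq; case: ifP; rewrite ?mulr0 // mulrC.
    by apply: eq_bigl => j; rewrite andbC.
  have -> : \sum_(i | i != u) x u * (if K u i then x i else 0) = x u * nbsum K x u.
    rewrite -mulr_sumr; congr (_ * _); rewrite /nbsum [RHS]big_mkcond [RHS](bigD1 u) //=.
    by rewrite (negbTE Ku) add0r.
  ring.
rewrite (split_ G) // (split_ H) //.
have -> : \sum_(i | i != u) x i * \sum_(j | (j != u) && H i j) x j =
   \sum_(i | i != u) x i * \sum_(j | (j != u) && G i j) x j.
  apply: eq_bigr => i iu; congr (_ * _); apply: eq_bigl => j.
  by case: (boolP (j == u)) => //= ju; rewrite agree.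
ring.
Qed.

Lemma is_top_iso G H rho : isomorphic G H -> is_top H rho -> is_top G rho.
Proof.
move=> [f [fb fE]] [leM [x [x0 E]]].
have nb y i : nbsum G (fun i => y (f i)) i = nbsum H y (f i).
  rewrite /nbsum [RHS](reindex f) /=; last exact: onW_bij.
  by apply: eq_bigl => j; rewrite fE.
have sq y : sqnorm (fun i => y (f i)) = sqnorm y.
  by rewrite /sqnorm [RHS](reindex f) //=; exact: onW_bij.
have [g fg gf] := fb; split=> [y|].
  pose z j := y (g j).
  have -> : y = (fun i => z (f i)) by apply/funext => i; rewrite /z fg.
  rewrite sq; apply: le_trans (leM _); rewrite /quad [leRHS](reindex f) /=; last exact: onW_bij.
  by apply: ler_sum => i _; rewrite -nb.
by exists (fun i => x (f i)); rewrite sq; split=> // i; rewrite nb E.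
Qed.

End Quadratic.

(** * Block graphs *)

Section BlockGraph.
Variables (n r : nat).
Implicit Types (l : {ffun 'I_n -> option 'I_r}) (u v : 'I_n) (N : {set 'I_n}).

(* The label None marks the cut and Some a the a-th block; the label of v is irrelevant to the graph. *)
Definition block_graph l v N : rel 'I_n := fun i j =>
  (i != j) && (if i == v then j \in N else if j == v then i \in N
               else [|| l i == None, l j == None | l i == l j]).

Definition relabel l u b : {ffun 'I_n -> option 'I_r} :=
  [ffun i => if i == u then b else l i].

Lemma block_graph_sym l v N : symmetric (block_graph l v N).
Proof.
move=> i j; rewrite /block_graph [j == i]eq_sym; case: eqVneq => //= ij.
case: (eqVneq i v) => iv; case: (eqVneq j v) => jv //.
  by rewrite iv jv eqxx in ij.
by rewrite [l j == l i]eq_sym orbCA.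
Qed.

Lemma block_graph_irr l v N u : ~~ block_graph l v N u u.
Proof. by rewrite /block_graph eqxx. Qed.

Lemma relabel_same l u b : relabel l u b u = b.
Proof. by rewrite ffunE eqxx. Qed.

Lemma relabel_other l u b i : i != u -> relabel l u b i = l i.
Proof. by rewrite ffunE => /negbTE->. Qed.

Lemma block_graph_label l l' v N : (forall i, i != v -> l i = l' i) ->
  block_graph l v N =2 block_graph l' v N.
Proof.
move=> E i j; rewrite /block_graph; case: eqVneq => //= ij.
by case: eqVneq => // iv; case: eqVneq => // jv; rewrite !E.
Qed.

(** With this neighbourhood [v] is an ordinary member of its block, so the graph depends on the
    labels alone and another vertex may be declared special. *)
Lemma block_graph_plain l v a : l v = Some a ->
  block_graph l v [set i | (i != v) && ((l i == None) || (l i == Some a))] =2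
  (fun i j => (i != j) && [|| l i == None, l j == None | l i == l j]).
Proof.
move=> lv i j; rewrite /block_graph !inE; case: eqVneq => //= ij.
case: (eqVneq i v) => [iv|iv].
  have jv : j != v by rewrite -iv eq_sym.
  by rewrite iv lv jv /= [Some a == _]eq_sym.
by case: (eqVneq j v) => [->|//]; rewrite lv.
Qed.

(** The cut vertex [d] is a hub for all vertices other than [v], and [v] reaches it through [t]. *)
Lemma block_graph_connected l v N d t : v \notin N -> d != v -> l d = None ->
  t \in N -> forall i j, connect (block_graph l v N) i j.
Proof.
move=> vN dv ld tN.
have cs : connect_sym (block_graph l v N).
  by apply: sym_connect_sym; exact: block_graph_sym.
have cd i : i != v -> connect (block_graph l v N) i d.
  move=> iv; have [->//|id] := eqVneq i d.
  by apply: connect1; rewrite /block_graph id (negbTE iv) (negbTE dv) ld orbT.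
have cv i : connect (block_graph l v N) i d.
  have [->|/cd//] := eqVneq i v; apply: (@connect_trans _ _ t).
    by apply: connect1; rewrite /block_graph eqxx tN andbT; apply: contraNneq vN => ->.
  by apply: cd; apply: contraNneq vN => <-.
by move=> i j; apply: connect_trans (cv i) _; rewrite cs.
Qed.

(** * Weights of label classes and the effect of relabelling on the quadratic form *)

Section Sums.
Local Open Scope ring_scope.
Variable R : realType.
Implicit Types x : 'I_n -> R.

(** The special vertex is left out because its edges are governed by [N] and not by its label. *)
Definition lsum l v x b : R := \sum_(j | (j != v) && (l j == b)) x j.
Definition tsum v x : R := \sum_(j | j != v) x j.

Lemma quad_ext (G H : rel 'I_n) x : G =2 H -> quad G x = quad H x.
Proof.
by move=> E; apply: eq_bigr => i _; congr (_ * _); apply: eq_bigl => j; rewrite E.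
Qed.

Lemma nbsum_special l v N x : v \notin N ->
  nbsum (block_graph l v N) x v = \sum_(j in N) x j.
Proof.
move=> vN; apply: eq_bigl => j; rewrite /block_graph eqxx.
by case: eqVneq => // <-; rewrite (negbTE vN).
Qed.

Lemma nbsum_split G x v u : u != v ->
  nbsum G x u = (if G u v then x v else 0) + \sum_(j | (j != v) && G u j) x j.
Proof.
move=> uv; rewrite /nbsum (bigID (fun j => j == v)) /=; congr (_ + _).
  rewrite (eq_bigl (fun j => (j == v) && G u v)).
    by rewrite big_mkcondr big_pred1_eq.
  by move=> j; case: eqP => [->|]; rewrite ?andbF // andbT.
by apply: eq_bigl => j; rewrite andbC.
Qed.

(** Adding [x u] on the left lets the sum on the right run over [u] as well. *)
Lemma nbsum_cut l v N x u : u != v -> l u = None ->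
  nbsum (block_graph l v N) x u + x u =
  (if u \in N then x v else 0) + tsum v x.
Proof.
move=> uv lu; rewrite (nbsum_split _ _ uv) /block_graph uv (negbTE uv) eqxx /=.
rewrite -addrA; congr (_ + _); rewrite /tsum [RHS](bigD1 u) //= addrC; congr (_ + _).
apply: eq_bigl => j; rewrite lu eqxx /= [u == j]eq_sym.
by case: (j == v); rewrite //= andbT.
Qed.

Lemma nbsum_block l v N x u a : u != v -> l u = Some a ->
  nbsum (block_graph l v N) x u + x u =
  (if u \in N then x v else 0) + lsum l v x None + lsum l v x (Some a).
Proof.
move=> uv lu; rewrite (nbsum_split _ _ uv) /block_graph uv (negbTE uv) eqxx /=.
rewrite -!addrA; congr (_ + _).
rewrite [lsum _ _ _ (Some a)](bigD1 u) /=; last by rewrite uv lu eqxx.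
rewrite addrCA addrC; congr (_ + _).
rewrite (bigID (fun j => l j == None)) /=; congr (_ + _); apply: eq_bigl => j.
  rewrite [u == j]eq_sym lu; case: (eqVneq j v) => //= jv.
  case: (eqVneq (l j) None) => [E|]; rewrite ?andbF // !andbT.
  by apply/eqP => ju; rewrite ju lu in E.
rewrite [u == j]eq_sym lu; case: (eqVneq j v) => //= jv.
case: (eqVneq (l j) None) => [->|]; rewrite ?andbF //= andbT.
by rewrite [Some a == _]eq_sym andbC.
Qed.

Lemma lsum_relabel l v x u b c : u != v ->
  lsum (relabel l u b) v x c =
  lsum l v x c - (if l u == c then x u else 0) + (if b == c then x u else 0).
Proof.
move=> uv.
have W l' : lsum l' v x c = (if l' u == c then x u else 0) +
    \sum_(j | (j != u) && ((j != v) && (l' j == c))) x j.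
  rewrite /lsum (bigID (fun j => j == u)) /=; congr (_ + _).
    rewrite (eq_bigl (fun j => (j == u) && (l' u == c))).
      by rewrite big_mkcondr big_pred1_eq.
    by move=> j; case: (eqVneq j u) => [->|]; rewrite ?andbF // uv andbT.
  by apply: eq_bigl => j; rewrite andbC.
rewrite (W l) (W (relabel l u b)) relabel_same [_ + \sum_(_ | _) _]addrC.
rewrite (eq_bigl (fun j => (j != u) && ((j != v) && (l j == c)))); last first.
  by move=> j; case: (boolP (j == u)) => //= ju; rewrite relabel_other.
ring.
Qed.

Lemma lsum_ge0 l v x b : (forall i, 0 <= x i) -> 0 <= lsum l v x b.
Proof. by move=> x0; apply: sumr_ge0. Qed.

Lemma lsum_ge l v x u b : (forall i, 0 <= x i) -> u != v -> l u = b ->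
  x u <= lsum l v x b.
Proof.
move=> x0 uv lu; rewrite /lsum (bigD1 u) /=; last by rewrite uv lu eqxx.
by rewrite lerDl; apply: sumr_ge0.
Qed.

Lemma lsum_ge2 l v x u t b : (forall i, 0 <= x i) -> u != v -> l u = b ->
  t != v -> l t = b -> t != u -> x u + x t <= lsum l v x b.
Proof.
move=> x0 uv lu tv lt tu; rewrite /lsum (bigD1 u) /=; last by rewrite uv lu eqxx.
rewrite lerD2l (bigD1 t) /=; last by rewrite tv lt eqxx.
by rewrite lerDl; apply: sumr_ge0.
Qed.

Lemma tsum_ge l v x a b : (forall i, 0 <= x i) -> a != b ->
  lsum l v x None + lsum l v x (Some a) + lsum l v x (Some b) <= tsum v x.
Proof.
move=> x0 ab; have -> : tsum v x = \sum_c lsum l v x c.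
  by rewrite /tsum (partition_big l xpredT).
rewrite (bigD1 None) //= (bigD1 (Some a)) //= (bigD1 (Some b)) /=; last first.
  by rewrite (inj_eq Some_inj) eq_sym.
by rewrite -!addrA !lerD2l lerDl; apply: sumr_ge0 => c _; exact: lsum_ge0.
Qed.

Lemma quad_nbhd l v N N' x : v \notin N -> v \notin N' ->
  quad (block_graph l v N') x = quad (block_graph l v N) x +
    2 * x v * (\sum_(j in N') x j - \sum_(j in N) x j).
Proof.
move=> vN vN'; rewrite -(nbsum_special l x vN) -(nbsum_special l x vN').
apply: quad_change; rewrite ?block_graph_irr //; try exact: block_graph_sym.
by move=> i j iv jv; rewrite /block_graph (negbTE iv) (negbTE jv).
Qed.

Lemma quad_relabel l v N x u b : u != v ->
  quad (block_graph (relabel l u b) v N) x = quad (block_graph l v N) x +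
    2 * x u * (nbsum (block_graph (relabel l u b) v N) x u
               - nbsum (block_graph l v N) x u).
Proof.
move=> uv; apply: quad_change; rewrite ?block_graph_irr //; try exact: block_graph_sym.
by move=> i j iu ju; rewrite /block_graph !relabel_other.
Qed.

(** The vertex loses block [a] and gains block [b]; its adjacency to the cut and to [v] is
    unchanged. The extra [x u] corrects for [u] being counted in the weight of block [a]. *)
Lemma quad_block_block l v N x u a b : u != v -> l u = Some a -> a != b ->
  quad (block_graph (relabel l u (Some b)) v N) x = quad (block_graph l v N) x +
    2 * x u * (lsum l v x (Some b) - lsum l v x (Some a) + x u).
Proof.
move=> uv lu ab; rewrite quad_relabel //; congr (_ + _ * _).
have := nbsum_block N x uv lu.
have := nbsum_block N x uv (relabel_same l u (Some b)).
rewrite !lsum_relabel // lu eqxx /= (inj_eq Some_inj) (negbTE ab); lra.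
Qed.

Lemma quad_block_cut l v N x u a : u != v -> l u = Some a ->
  quad (block_graph (relabel l u None) v N) x = quad (block_graph l v N) x +
    2 * x u * (tsum v x - lsum l v x None - lsum l v x (Some a)).
Proof.
move=> uv lu; rewrite quad_relabel //; congr (_ + _ * _).
have := nbsum_block N x uv lu.
have := nbsum_cut N x uv (relabel_same l u None); lra.
Qed.

Lemma quad_cut_block l v N x u a : u != v -> l u = None ->
  quad (block_graph (relabel l u (Some a)) v N) x = quad (block_graph l v N) x -
    2 * x u * (tsum v x - lsum l v x None - lsum l v x (Some a)).
Proof.
move=> uv lu; rewrite quad_relabel // -mulrN; congr (_ + _ * _).
have := nbsum_cut N x uv lu.
have := nbsum_block N x uv (relabel_same l u (Some a)).
rewrite !lsum_relabel // lu !eqxx /=; lra.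
Qed.

(** Two successive relabellings, so that the formulas for a single move compose; [label_swapE] shows
    that it is composition with a transposition. *)
Definition label_swap l c d := relabel (relabel l c (l d)) d (l c).

(** Among ordinary vertices, a cut vertex sees the blocks other than [a] and a vertex of block [a]
    does not; the last factor is the weight of those blocks. [N] is kept as a set of vertices. *)
Lemma quad_swap_cut l v N x c d a : c != v -> d != v -> l c = Some a -> l d = None ->
  quad (block_graph (label_swap l c d) v N) x = quad (block_graph l v N) x +
    2 * (x c - x d) * (tsum v x - lsum l v x None - lsum l v x (Some a)).
Proof.
move=> cv dv lc ld; rewrite /label_swap lc ld.
have dc : d != c by apply: contraPneq ld => ->; rewrite lc.
rewrite quad_cut_block ?relabel_other // (quad_block_cut _ _ cv lc).
rewrite !lsum_relabel // lc !eqxx /=; lra.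
Qed.

Lemma quad_swap_block l v N x c d a b : c != v -> d != v ->
    l c = Some a -> l d = Some b -> a != b ->
  quad (block_graph (label_swap l c d) v N) x = quad (block_graph l v N) x +
    2 * (x d - x c) * (lsum l v x (Some a) - lsum l v x (Some b) + x d - x c).
Proof.
move=> cv dv lc ld ab; rewrite /label_swap lc ld.
have dc : d != c.
  by apply: contra ab => /eqP E; move: ld; rewrite E lc => -[->].
rewrite (@quad_block_block _ _ _ _ _ b) ?relabel_other // 1?eq_sym //.
rewrite (quad_block_block _ _ cv lc ab).
rewrite !lsum_relabel // lc !eqxx /= !(inj_eq Some_inj) (negbTE ab) [b == a]eq_sym (negbTE ab).
lra.
Qed.

End Sums.
End BlockGraph.

(** * Maximal block graphs *)

Section Class.
Variables (n r k h delta : nat).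
Implicit Types (l : {ffun 'I_n -> option 'I_r}) (u v : 'I_n) (N : {set 'I_n}).

Definition lset l b : {set 'I_n} := [set i | l i == b].

(** The class sizes count [v] under its label, so that label matters here although the graph ignores
    it. In the application [h] is the maximum of the given [h] and [delta - k]. *)
Definition cut_labelling l v N : Prop :=
  [/\ #|lset l None| = k, forall a, h < #|lset l (Some a)|, v \notin N & #|N| = delta].

(** The neighbour [t] inside the block is the reason why at most [delta - 1] neighbours of [v] can
    lie in the cut. *)
Definition attached l v N : Prop :=
  exists a, [/\ l v = Some a, forall i, i \in N -> l i = None \/ l i = Some a
    & exists2 t, t \in N & l t = Some a].

Lemma lset_relabel l u b c :
  lset (relabel l u b) c = if b == c then u |: lset l c else lset l c :\ u.
Proof.
apply/setP => i; rewrite inE ffunE; case: (eqVneq i u) => [->|iu]; case: ifP => E;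
by rewrite !inE ?eqxx ?(negbTE iu).
Qed.

Lemma label_swapE l c d i : label_swap l c d i = l (tperm c d i).
Proof.
rewrite !ffunE; case: tpermP => [->|->|/eqP ic /eqP di].
- by case: eqVneq => [->|]; rewrite ?eqxx.
- by rewrite eqxx.
- by rewrite (negbTE ic) (negbTE di).
Qed.

Lemma label_swap_l l c d : label_swap l c d c = l d.
Proof. by rewrite label_swapE tpermL. Qed.

Lemma label_swap_r l c d : label_swap l c d d = l c.
Proof. by rewrite label_swapE tpermR. Qed.

Lemma label_swap_other l c d i : i != c -> i != d -> label_swap l c d i = l i.
Proof. by move=> ic di; rewrite label_swapE tpermD // eq_sym. Qed.

Lemma card_lset_swap l c d b : #|lset (label_swap l c d) b| = #|lset l b|.
Proof.
rewrite -(card_preimset (lset l b) (@perm_inj _ (tperm c d))).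
by apply: eq_card => i; rewrite !inE label_swapE.
Qed.

Lemma cut_labelling_swap l v N c d :
  cut_labelling l v N -> cut_labelling (label_swap l c d) v N.
Proof.
by move=> [c0 ca vN cN]; split=> // [|a]; rewrite card_lset_swap.
Qed.

Lemma card_replace N c d : c \in N -> d \notin N -> #|d |: (N :\ c)| = #|N|.
Proof.
move=> cN dN; rewrite cardsU1 !inE (negbTE dN) andbF /= (cardsD1 c N) cN.
by [].
Qed.

Lemma cut_labelling_replace l v N c d : d != v -> c \in N -> d \notin N ->
  cut_labelling l v N -> cut_labelling l v (d |: (N :\ c)).
Proof.
move=> dv cN dN [c0 ca vN c1]; split; rewrite ?card_replace //.
by rewrite !inE negb_or eq_sym dv (negbTE vN) andbF.
Qed.

Lemma sub_card_exists (T : finType) (A : {set T}) m : m <= #|A| ->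
  exists2 B : {set T}, B \subset A & #|B| = m.
Proof.
elim: m => [|m IH] lm; first by exists set0; rewrite ?sub0set ?cards0.
have [B BA cB] := IH (ltnW lm).
have /set0Pn[y] : A :\: B != set0.
  by rewrite -card_gt0 cardsD (setIidPr BA) subn_gt0 cB.
rewrite inE => /andP[yB yA]; exists (y |: B).
  by apply/subsetP => z; rewrite !inE => /orP[/eqP->//|/(subsetP BA)].
by rewrite cardsU1 yB cB.
Qed.

Lemma other_block (a : 'I_r) : 1 < r -> exists b : 'I_r, a != b.
Proof.
move=> r2; have [E|a0] := eqVneq (a : nat) 0.
  by exists (Ordinal r2); rewrite -val_eqE /= E.
by exists (Ordinal (ltnW r2)); rewrite -val_eqE.
Qed.

Section Maximal.
Local Open Scope ring_scope.
Variable R : realType.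
Implicit Types x : 'I_n -> R.

Hypotheses (k1 : (1 <= k)%N) (h1 : (1 <= h)%N) (r2 : (1 < r)%N) (dkh : (delta <= k + h)%N).

Lemma sum_const (A : {set 'I_n}) x c : (forall i, i \in A -> x i = c) ->
  \sum_(i in A) x i = #|A|%:R * c.
Proof.
by move=> E; rewrite (eq_bigr (fun=> c)) // sumr_const mulr_natl.
Qed.

Lemma sum_replace N c d x : c \in N -> d \notin N ->
  \sum_(i in d |: (N :\ c)) x i = \sum_(i in N) x i + x d - x c.
Proof.
move=> cN dN; rewrite big_setU1 ?inE ?(negbTE dN) ?andbF //= (big_setD1 c cN) /=; ring.
Qed.

Lemma class_connected l v N a : cut_labelling l v N -> l v = Some a ->
  (exists t, t \in N) -> forall i j, connect (block_graph l v N) i j.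
Proof.
move=> [c0 ca vN _] lv [t tN].
have /set0Pn[d] : lset l None != set0 by rewrite -card_gt0 c0.
rewrite inE => /eqP ld; apply: (@block_graph_connected _ _ _ _ _ d t) => //.
by apply: contraPneq ld => ->; rewrite lv.
Qed.

(** * Structure forced by maximality *)

Section Max.
Variables (l : {ffun 'I_n -> option 'I_r}) (v : 'I_n) (N : {set 'I_n}) (rho : R) (x : 'I_n -> R).
Variable a0 : 'I_r.
Hypotheses (lc : cut_labelling l v N) (lv : l v = Some a0)
  (N0 : forall i, i \in N -> l i = None \/ l i = Some a0)
  (Nt : exists2 t, t \in N & l t = Some a0).
Hypotheses (x0 : forall i, 0 < x i)
  (xE : forall i, nbsum (block_graph l v N) x i = rho * x i).
(** Maximality of the spectral radius as seen by the fixed eigenvector [x]; [maximal_extremal]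
    derives it from [top_step]. *)
Hypothesis max : forall l' v' N', cut_labelling l' v' N' -> attached l' v' N' ->
  quad (block_graph l' v' N') x <= quad (block_graph l v N) x /\
  (quad (block_graph l' v' N') x = quad (block_graph l v N) x ->
   forall i, nbsum (block_graph l' v' N') x i = nbsum (block_graph l v N) x i).

Let x0w i : 0 <= x i := ltW (x0 i).

Lemma cut_neq_special i : l i = None -> i != v.
Proof. by move=> li; apply: contraPneq li => ->; rewrite lv. Qed.

Lemma nbhd_neq i : i \in N -> i != v.
Proof. by case: lc => _ _ vN _; apply: contraTneq => ->. Qed.

Lemma lset_exists b : exists u, l u = Some b.
Proof.
case: lc => _ ca _ _; have /set0Pn[u] : lset l (Some b) != set0.
  by rewrite -card_gt0; apply: leq_trans (ca b).
by rewrite inE => /eqP; exists u.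
Qed.

(** Given two neighbours [t] and [s] of [v] in its block, either [d] replaces [t] in [N], or [t] and
    [d] exchange labels, whichever favours the larger entry. The second neighbour [s] keeps the new
    graph in the class. *)
Lemma max_cut_full d : l d = None -> d \notin N -> (#|N :&: lset l (Some a0)| <= 1)%N.
Proof.
move=> ld dN; rewrite leqNgt; apply/negP => /card_gt1P [t [s [tA sA ts]]].
move: tA sA; rewrite !inE => /andP[tN /eqP lt] /andP[sN /eqP ls].
have dv := cut_neq_special ld; have tv := nbhd_neq tN.
have [xdt|xtd] := leP (x t) (x d).
  have [] := max (cut_labelling_replace dv tN dN lc).
    exists a0; split=> // [i|]; last by exists s; rewrite // !inE [s == t]eq_sym ts sN orbT.
    by rewrite !inE => /orP[/eqP->|/andP[_ /N0]] //; left.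
  case: (lc) => _ _ vN _.
  have vN' : v \notin d |: (N :\ t) by rewrite !inE negb_or eq_sym dv (negbTE vN) andbF.
  rewrite (quad_nbhd _ _ vN vN') sum_replace // => le eq.
  have : 0 <= 2 * x v * (x d - x t).
    by rewrite !mulr_ge0 // subr_ge0.
  move=> ge; have E : 2 * x v * (\sum_(j in N) x j + x d - x t - \sum_(j in N) x j) = 2 * x v * (x d - x t).
    by ring.
  (* The form may stay constant here, when [x t = x d]; the contradiction then comes from the
     neighbour sum at [d], which grows by [x v]. *)
  have := eq _ d; rewrite E in le *; have := nbsum_cut N x dv ld.
  have := nbsum_cut (d |: N :\ t) x dv ld; rewrite !inE eqxx (negbTE dN) /=.
  have := x0 v; lra.
have [] := max (cut_labelling_swap t d lc).
  have vt : v != t by rewrite eq_sym.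
  have vd : v != d by rewrite eq_sym.
  exists a0; split; first by rewrite label_swap_other.
    move=> i iN; have [->|it] := eqVneq i t; first by rewrite label_swap_l; left.
    have id : i != d by apply: contraNneq dN => <-.
    by rewrite label_swap_other //; exact: N0.
  exists s => //; rewrite label_swap_other // 1?eq_sym //.
  by apply: contraNneq dN => ->.
rewrite (quad_swap_cut _ _ tv dv lt ld).
have [b ab] := other_block a0 r2; have [u lu] := lset_exists b.
have uv : u != v by apply: contraNneq ab => E; move: lu; rewrite E lv => -[->].
have := tsum_ge l v x0w ab; have := lsum_ge x0w uv lu; have := x0 u.
move=> p1 p2 p3; suff : 0 < (x t - x d) * (tsum v x - lsum l v x None - lsum l v x (Some a0)) by lra.
apply: mulr_gt0; lra.
Qed.

(** With two or more neighbours in the block the whole cut lies in [N], which leaves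
    [delta - k <= h] of them. *)
Lemma nbhd_block_card : (#|N :&: lset l (Some a0)| <= h)%N.
Proof.
have [//|lt1] := leqP #|N :&: lset l (Some a0)| 1; first by move=> /leq_trans; apply.
have cutN : lset l None \subset N.
  apply/subsetP => d; rewrite inE => /eqP ld; apply: contraTT lt1 => dN.
  by rewrite -leqNgt (max_cut_full ld).
case: lc => c0 _ _ cN; move: dkh; rewrite -cN -c0 => le.
rewrite -(leq_add2l #|lset l None|); apply: leq_trans le.
rewrite -(cardsID (lset l None) N) (setIidPr cutN) leq_add2l; apply: subset_leq_card.
by apply/subsetP => i; rewrite !inE => /andP[-> /eqP->].
Qed.

Lemma nbhd_not_special : v \notin N. Proof. by case: lc. Qed.

(** In the block of [v], the vertex [v] and its neighbours account for at most [h + 1] vertices;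
    other blocks do not meet [N]. The vertex found can change block without affecting [N]. *)
Lemma block_vertex_free b : (h.+1 < #|lset l (Some b)|)%N ->
  exists u, [/\ l u = Some b, u != v & u \notin N].
Proof.
move=> hb; have [ab|ab] := eqVneq a0 b; last first.
  have [u lu] := lset_exists b; exists u; split=> //.
    by apply: contraNneq ab => E; move: lu; rewrite E lv => -[->].
  by apply: contraNN ab => /N0; rewrite lu => -[//|[->]].
have /subsetPn[u] : ~~ (lset l (Some b) \subset v |: (N :&: lset l (Some a0))).
  apply: contraTN hb => /subset_leq_card; rewrite -leqNgt => /leq_trans; apply.
  by rewrite cardsU1 -add1n leq_add ?leq_b1 ?nbhd_block_card.
rewrite !inE ab negb_or negb_and => /eqP lu; rewrite lu eqxx orbF => /andP[uv uN].
by exists u.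
Qed.

(** Moving a free vertex from the lighter of two large blocks to the heavier one strictly increases
    the form. *)
Lemma max_one_large b c : b != c ->
  (h.+1 < #|lset l (Some b)|)%N -> (#|lset l (Some c)| <= h.+1)%N.
Proof.
move=> bc hb; rewrite leqNgt; apply/negP => hc.
wlog le : b c bc hb hc / lsum l v x (Some b) <= lsum l v x (Some c).
  move=> W; have [?|/ltW ?] := leP (lsum l v x (Some b)) (lsum l v x (Some c)).
    exact: (W b c).
  by apply: (W c b) => //; rewrite eq_sym.
have [u [lu uv uN]] := block_vertex_free hb.
have uN' i : i \in N -> i != u by apply: contraTneq => ->.
have [||le' _] := max (l' := relabel l u (Some c)) (v' := v) (N' := N).
- case: (lc) => c0 ca vN cN; split=> // [|a]; rewrite lset_relabel /=.
    rewrite -c0; apply: eq_card => i; rewrite !inE.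
    by case: eqVneq => // ->; rewrite lu.
  case: eqP => [[<-]|_]; first by apply: leq_trans (ca c) _; apply/subset_leq_card/subsetUr.
  have [<-|ba] := eqVneq b a.
    by rewrite -ltnS; apply: leq_trans hb _; rewrite (cardsD1 u) inE lu eqxx.
  rewrite (_ : lset l (Some a) :\ u = lset l (Some a)) //.
  apply/setP => i; rewrite !inE; case: eqVneq => // ->.
  by rewrite lu (inj_eq Some_inj) (negbTE ba).
- exists a0; split; first by rewrite relabel_other // eq_sym.
    by move=> i iN; rewrite relabel_other ?uN' //; exact: N0.
  by have [t tN lt] := Nt; exists t => //; rewrite relabel_other ?uN'.
move: le'; rewrite (quad_block_block _ _ uv lu bc) => le'.
have : 0 < x u * (lsum l v x (Some c) - lsum l v x (Some b) + x u).
  by apply: mulr_gt0 => //; have := x0 u; lra.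
lra.
Qed.

(* Otherwise v and a vertex u of a smaller block b exchange their roles: the one with the smaller entry of x becomes the special vertex in b, the other a full member of the block a0. *)
Lemma max_special_block : (#|lset l (Some a0)| <= h.+1)%N.
Proof.
rewrite leqNgt; apply/negP => hs.
have [b ab] := other_block a0 r2.
have hb : #|lset l (Some b)| = h.+1.
  by apply/eqP; rewrite eqn_leq (max_one_large ab hs); case: lc => _ ca _ _; rewrite ca.
have b_neq i : l i = Some b -> i != v.
  by move=> li; apply: contraNneq ab => E; move: li; rewrite E lv => -[->].
have b_out i : l i = Some b -> i \notin N.
  by move=> li; apply: contraNN ab => /N0; rewrite li => -[//|[->]].
have [u lu] := lset_exists b; have uv := b_neq _ lu; have uN := b_out _ lu.
set A := N :&: lset l (Some a0); have Ah : (#|A| <= h)%N := nbhd_block_card.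
have A1 : (0 < #|A|)%N.
  by have [t tN lt] := Nt; apply/card_gt0P; exists t; rewrite !inE tN lt eqxx.
(* [J] replaces [A]: the new special vertex keeps its degree, with its neighbours in block [b].
   There is room because [A] has at most [h] elements. *)
have [J Jsub cJ] : exists2 J : {set 'I_n}, J \subset lset l (Some b) :\ u & #|J| = #|A|.
  by apply: sub_card_exists; move: hb; rewrite (cardsD1 u) inE lu eqxx add1n => /succn_inj ->.
have Jb i : i \in J -> l i = Some b.
  by move/(subsetP Jsub); rewrite !inE => /andP[_ /eqP].
have uJ : u \notin J by apply/negP => /(subsetP Jsub); rewrite !inE eqxx.
pose C := N :&: lset l None; pose N' := C :|: J.
have CE i : i \in C -> i \in N /\ l i = None by rewrite !inE => /andP[? /eqP].
have vN' : v \notin N'.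
  rewrite !inE lv andbF /=; apply/negP => /Jb; rewrite lv => -[E].
  by rewrite E eqxx in ab.
have uN' : u \notin N' by rewrite !inE lu andbF /=.
have dCJ : [disjoint C & J].
  by rewrite disjoint_subset; apply/subsetP => i /CE [_ li]; apply/negP => /Jb; rewrite li.
have NE : N = C :|: A.
  apply/setP => i; rewrite !inE -andb_orr; case: (boolP (i \in N)) => //= /N0.
  by case=> ->; rewrite eqxx ?orbT.
have dCA : [disjoint C & A].
  by rewrite disjoint_subset; apply/subsetP => i /CE [_ li]; rewrite !inE li andbF.
have cN' : #|N'| = delta.
  case: lc => _ _ _ <-; rewrite [in RHS]NE !cardsU cJ.
  by rewrite (disjoint_setI0 dCJ) (disjoint_setI0 dCA).
have sN' : \sum_(i in N') x i = \sum_(i in C) x i + \sum_(i in J) x i.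
  by rewrite -bigU //; apply: eq_bigl => i; rewrite inE.
have sN : \sum_(i in N) x i = \sum_(i in C) x i + \sum_(i in A) x i.
  by rewrite {1}NE -bigU //; apply: eq_bigl => i; rewrite inE.
set S0 := lsum l v x None; set Fa := lsum l v x (Some a0); set Fb := lsum l v x (Some b).
(* All vertices of block [b] satisfy the same eigenvalue equation, so they share the entry [x u].
   Likewise the vertices of [B], in the block of [v] but outside [N], will share the entry [c]. *)
have eqb i : l i = Some b -> (rho + 1) * x i = S0 + Fb.
  move=> li; have := nbsum_block N x (b_neq _ li) li.
  rewrite xE (negbTE (b_out _ li)) -/S0 -/Fb; lra.
have S0_gt0 : 0 < S0.
  have /set0Pn[d] : lset l None != set0 by case: lc => c0 _ _ _; rewrite -card_gt0 c0.
  rewrite inE => /eqP ld; apply: lt_le_trans (x0 d) _.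
  by apply: lsum_ge => //; apply: cut_neq_special.
have Fb_ge0 : 0 <= Fb by exact: lsum_ge0.
have rho1 : 0 < rho + 1.
  have : 0 < (rho + 1) * x u by rewrite eqb //; lra.
  by rewrite pmulr_lgt0.
have xb i : l i = Some b -> x i = x u.
  move=> li; apply: (mulfI (lt0r_neq0 rho1)).
  by rewrite !eqb.
have FbE : Fb = h.+1%:R * x u.
  rewrite -hb -(@sum_const (lset l (Some b)) x); last by move=> i; rewrite inE => /eqP /xb.
  apply: eq_bigl => i; rewrite inE; case: eqVneq => [->|//].
  by rewrite lv (inj_eq Some_inj) (negbTE ab).
have sJ : \sum_(i in J) x i = #|A|%:R * x u.
  by rewrite -cJ; apply: sum_const => i /Jb /xb.
pose B := (lset l (Some a0) :\ v) :\: N.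
have BE i : i \in B -> [/\ l i = Some a0, i != v & i \notin N].
  by rewrite !inE => /and3P[-> -> /eqP].
pose c := (S0 + Fa) / (rho + 1).
have c1 : (rho + 1) * c = S0 + Fa by rewrite mulrC divfK ?lt0r_neq0.
have xB i : i \in B -> x i = c.
  move=> /BE [li iv iN]; apply: (mulfI (lt0r_neq0 rho1)); rewrite c1.
  have := nbsum_block N x iv li; rewrite xE (negbTE iN) -/S0 -/Fa; lra.
have xA i : i \in A -> c <= x i.
  rewrite !inE => /andP[iN /eqP li]; rewrite -(ler_pM2l rho1) c1.
  have := nbsum_block N x (nbhd_neq iN) li; rewrite xE iN -/S0 -/Fa; have := x0 v; lra.
have sA : #|A|%:R * c <= \sum_(i in A) x i.
  by rewrite -(@sum_const A (fun=> c)) //; apply: ler_sum.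
have dAB : [disjoint A & B].
  by rewrite disjoint_subset; apply/subsetP => i; rewrite !inE => /andP[->].
have ABE i : (i \in A) || (i \in B) = (i != v) && (l i == Some a0).
  rewrite !inE; case: (eqVneq i v) => [->|_] /=; last by case: (i \in N); rewrite ?andbT ?orbF.
  by rewrite (negbTE nbhd_not_special) /=.
have FaE : Fa = \sum_(i in A) x i + #|B|%:R * c.
  rewrite -(sum_const xB) -bigU //; apply: eq_bigl => i.
  by rewrite inE ABE.
have cAB : (h < #|A| + #|B|)%N.
  rewrite -(leq_add2l 1) add1n; apply: leq_trans hs _.
  rewrite (cardsD1 v) leq_add ?leq_b1 //.
  have -> : (#|A| + #|B|)%N = #|A :|: B|.
    by rewrite cardsU (disjoint_setI0 dAB) cards0 subn0.
    by apply: subset_leq_card; apply/subsetP => i; rewrite in_setU ABE !inE.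
have Fa_ge0 : 0 <= Fa by exact: lsum_ge0.
have c0 : 0 <= c by apply: divr_ge0; lra.
have cABr : (h.+1%:R : R) <= #|A|%:R + #|B|%:R by rewrite -natrD ler_nat.
have xuc : x u <= c.
  (* Both [c] and [x u] are compared through the coefficient [rho + 1 - (h + 1)], which is positive
     because its product with [x u] equals [S0]. *)
  have le : S0 + h.+1%:R * c <= (rho + 1) * c.
    by rewrite c1 FaE; have := ler_wpM2r c0 cABr; lra.
  have eq : S0 + h.+1%:R * x u = (rho + 1) * x u by rewrite eqb // FbE.
  have w0 : 0 < rho + 1 - h.+1%:R by rewrite -(pmulr_lgt0 _ (x0 u)) mulrBl -eq; lra.
  rewrite -(ler_pM2l w0) !mulrBl; lra.
have gap : (h%:R - #|A|%:R) * x u < #|B|%:R * c.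
  have := x0 u; have := ler_wpM2r c0 cABr; rewrite -natr1.
  have : 0 <= (h%:R - #|A|%:R) * (c - x u) by rewrite mulr_ge0 ?subr_ge0 // ler_nat.
  lra.
have [xvu|xuv] := leP (x v) (x u).
  have [||le _] := max (l' := label_swap l u v) (v' := v) (N' := N').
  - by have [] := cut_labelling_swap u v lc; split.
  - exists b; rewrite label_swap_r; split=> // [i|].
      rewrite inE => /orP[/CE [_ li]|iJ].
        left; rewrite label_swap_other //; last exact: cut_neq_special.
        by apply: contraPneq li => ->; rewrite lu.
      right; rewrite label_swap_other ?Jb //; last by apply: b_neq; apply: Jb.
      by apply: contraNneq uJ => <-.
    have /card_gt0P[t tJ] : (0 < #|J|)%N by rewrite cJ.
    exists t; first by rewrite inE tJ orbT.
    rewrite label_swap_other ?Jb //; last by apply: b_neq; apply: Jb.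
    by apply: contraNneq uJ => <-.
  have E : block_graph (label_swap l u v) v N' =2 block_graph (relabel l u (Some a0)) v N'.
    by apply: block_graph_label => i iv; rewrite /label_swap relabel_other // lv.
  move: le; rewrite (quad_ext _ E) (quad_block_block _ _ uv lu) 1?eq_sym //.
  rewrite (quad_nbhd _ _ nbhd_not_special vN') sN sN' sJ -/Fa -/Fb FaE FbE -natr1.
  (* Half of the change of the form is this product plus [x u] times the difference of the two sides
     of [gap]. *)
  have : 0 <= (x u - x v) * (\sum_(i in A) x i - #|A|%:R * x u).
    by rewrite mulr_ge0 ?subr_ge0 //; apply: le_trans sA; apply: ler_wpM2l.
  have := mulr_gt0 (x0 u) (_ : 0 < #|B|%:R * c - (h%:R - #|A|%:R) * x u).
  rewrite subr_gt0 => /(_ gap); lra.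
have [||le _] := max (l' := l) (v' := u) (N' := N').
- by case: lc => p1 p2 _ _; split.
- exists b; split=> // [i|].
    by rewrite inE => /orP[/CE [_ li]|/Jb]; [left|right].
  have /card_gt0P[t tJ] : (0 < #|J|)%N by rewrite cJ.
  by exists t; [rewrite inE tJ orbT|exact: Jb].
(* Completing [v] in the old graph or [u] in the new one yields the same graph, through which the
   two forms are compared. *)
pose Nv := [set i | (i != v) && ((l i == None) || (l i == Some a0))].
pose Nu := [set i | (i != u) && ((l i == None) || (l i == Some b))].
have E : block_graph l v Nv =2 block_graph l u Nu.
  by move=> i j; rewrite (block_graph_plain lv) (block_graph_plain lu).
have vNv : v \notin Nv by rewrite inE eqxx.
have uNu : u \notin Nu by rewrite inE eqxx.
have sNv : \sum_(i in Nv) x i = S0 + Fa.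
  rewrite (bigID (fun i => l i == None)); congr (_ + _); apply: eq_bigl => i; rewrite inE /=.
    by case: (l i == None); rewrite ?andbT ?andbF.
  by case: (eqVneq (l i) None) => [->|]; rewrite ?andbF //= andbT.
have sNu : \sum_(i in Nu) x i = S0 + Fb - x u.
  rewrite (bigID (fun i => l i == None)) -addrA; congr (_ + _).
    apply: eq_bigl => i; rewrite inE /=; case: (eqVneq (l i) None) => [li|]; rewrite ?andbF //= !andbT.
    by rewrite (cut_neq_special li); apply/eqP => iu; rewrite iu lu in li.
  rewrite [Fb](bigD1 u) /=; last by rewrite uv lu eqxx.
  rewrite addrAC subrr add0r; apply: eq_bigl => i; rewrite inE.
  case: (eqVneq (l i) None) => [->|_]; rewrite ?andbF //= andbT andbC; congr (_ && _).
  by case: (eqVneq (l i) (Some b)) => [/b_neq ->|]; rewrite ?andbF.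
have q1 := quad_nbhd l x nbhd_not_special vNv.
have q2 := quad_nbhd l x uN' uNu.
have SC : \sum_(i in C) x i <= S0.
  rewrite /S0 /lsum big_mkcond [leRHS]big_mkcond; apply: ler_sum => i _.
  case: (boolP (i \in C)) => [/CE[_ li]|_]; last by case: ifP.
  by rewrite (cut_neq_special li) li eqxx.
have hA : 0 <= (h%:R - #|A|%:R) * x u by rewrite mulr_ge0 // subr_ge0 ler_nat.
(* [Q] is the weight of the neighbours that [u] loses. The weight gained by [v] exceeds it by [gap],
   and half of the change of the form is [x v] times this excess plus [(x v - x u) * Q]. *)
have [Q QE] : exists Q, Q = S0 - \sum_(i in C) x i + (h%:R - #|A|%:R) * x u by exists (S0 - \sum_(i in C) x i + (h%:R - #|A|%:R) * x u).
have Q0 : 0 <= (x v - x u) * Q by rewrite mulr_ge0 ?subr_ge0 ?(ltW xuv) // QE; lra.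
have PQ : 0 < x v * (S0 - \sum_(i in C) x i + #|B|%:R * c - Q).
  by rewrite mulr_gt0 // QE; lra.
move: le q1 q2; rewrite (quad_ext _ E) sNv sNu sN sN' sJ FaE FbE -(natr1 h) => le q1 q2.
rewrite QE in Q0 PQ; clear - q1 q2 Q0 PQ le.
lra.
Qed.

End Max.
End Maximal.
End Class.

(** * Moving the special vertex out of the cut *)

Section Reduction.
Local Open Scope ring_scope.
Variables (n r k h delta : nat) (R : realType).
Implicit Types (l : {ffun 'I_n -> option 'I_r}) (u v : 'I_n) (N : {set 'I_n})
  (x : 'I_n -> R).
Hypotheses (k1 : (1 <= k)%N) (h1 : (1 <= h)%N) (r2 : (1 < r)%N)
  (d1 : (1 <= delta)%N) (dkh : (delta <= k + h)%N).

Local Notation cut_labelling := (@cut_labelling n r k h delta).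

Lemma other_blocks_ge0 l v x a : (forall i, 0 <= x i) ->
  0 <= tsum v x - lsum l v x None - lsum l v x (Some a).
Proof.
move=> x0; have [b ab] := other_block a r2.
by have := tsum_ge l v x0 ab; have := lsum_ge0 l v (Some b) x0; lra.
Qed.

(** As long as a cut vertex [d] is missing from [N] and some [c] in [N] lies outside the cut, either
    [d] replaces [c] in [N] or the two exchange labels. Only nonnegativity of [x] is required, so
    the steps iterate with the same vector. *)
Lemma fill_cut l v N x : (forall i, 0 <= x i) -> cut_labelling l v N -> l v = None ->
  exists l' N', [/\ cut_labelling l' v N', l' v = None,
    quad (block_graph l v N) x <= quad (block_graph l' v N') x
    & N' \subset lset l' None \/ lset l' None :\ v \subset N'].
Proof.
move=> x0; have [m] := ubnP #|(lset l None :\ v) :\: N|.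
elim: m l N => // m IH l N; rewrite ltnS => ltm lc lv.
have [sub|/subsetPn[d]] := boolP (lset l None :\ v \subset N).
  by exists l, N; split=> //; right.
rewrite !inE => /andP[dv /eqP ld] dN.
have [sub|/subsetPn[c cN]] := boolP (N \subset lset l None).
  by exists l, N; split=> //; left.
rewrite inE; case lc' : (l c) => [a|] // _.
have cv : c != v by case: lc => _ _ vN _; apply: contraTneq cN => ->.
have cd : c != d by apply: contraNneq dN => <-.
have [le|lt] := leP (x c) (x d).
  have [||l' [N' [p1 p2 p3 p4]]] := IH l (d |: (N :\ c)) _ _ lv.
  - apply: leq_trans ltm; apply: proper_card; apply/properP; split.
      apply/subsetP => i; rewrite !inE !negb_or negb_and negbK.
      case: (eqVneq i c) => [->|_] /=; first by rewrite lc' !andbF.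
      by case/and3P => /andP[_ ->] -> ->.
    by exists d; rewrite !inE ?dN ?dv ?ld ?eqxx.
  - exact: cut_labelling_replace.
  exists l', N'; split=> //; apply: le_trans p3.
  have vN' : v \notin d |: (N :\ c).
    by case: (cut_labelling_replace dv cN dN lc).
  case: (lc) => _ _ vN _; rewrite (quad_nbhd _ _ vN vN') sum_replace // lerDl.
  by rewrite mulr_ge0 // ?mulr_ge0 //; lra.
have [||l' [N' [p1 p2 p3 p4]]] := IH (label_swap l c d) N _ (cut_labelling_swap c d lc).
- apply: leq_trans ltm; apply: proper_card; apply/properP; split.
    apply/subsetP => i; rewrite !inE; case: (eqVneq i c) => [->|ic]; first by rewrite cN.
    case: (eqVneq i d) => [->|id]; first by rewrite label_swap_r lc' !andbF.
    by rewrite label_swap_other.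
  by exists d; rewrite !inE ?dN ?dv ?ld ?eqxx // label_swap_r lc' andbF.
- by rewrite label_swap_other // eq_sym.
exists l', N'; split=> //; apply: le_trans p3.
rewrite (quad_swap_cut _ _ cv dv lc' ld) lerDl mulr_ge0 ?other_blocks_ge0 //.
by rewrite mulr_ge0 // subr_ge0 ltW.
Qed.

(** The same exchange gathers the neighbours outside the cut in the heaviest block [a]. A label
    exchange brings the larger entry into [a], so [a] remains heaviest. *)
Lemma fill_block l v N x a : (forall i, 0 <= x i) -> cut_labelling l v N -> l v = None ->
  lset l None :\ v \subset N ->
  (forall b, lsum l v x (Some b) <= lsum l v x (Some a)) ->
  exists l' N', [/\ cut_labelling l' v N', l' v = None,
    quad (block_graph l v N) x <= quad (block_graph l' v N') x,
    lset l' None :\ v \subset N' & N' \subset lset l' None :|: lset l' (Some a)].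
Proof.
move=> x0; have [m] := ubnP #|N :\: (lset l None :|: lset l (Some a))|.
elim: m l N => // m IH l N; rewrite ltnS => ltm lc lv cutN amax.
have [sub|/subsetPn[q qN]] := boolP (N \subset lset l None :|: lset l (Some a)).
  by exists l, N.
rewrite !inE; case lq : (l q) => [b|] //=; rewrite (inj_eq Some_inj) eq_sym => ab.
have qv : q != v by case: lc => _ _ vN _; apply: contraTneq qN => ->.
(* The cut without [v] supplies [k - 1] neighbours, so at most [h + 1] lie outside it, and [q] is
   one of these outside block [a]. Hence block [a] has a vertex [c] outside [N]. *)
have Na : (#|N :&: lset l (Some a)| <= h)%N.
  case: lc => c0 _ _ cN; move: dkh; rewrite -cN -c0 (cardsD1 v (lset l None)) inE lv eqxx add1n.
  rewrite -(cardsID (lset l None :\ v) N) (setIidPr cutN) addSnnS leq_add2l => le.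
  rewrite -ltnS; apply: leq_trans le.
  apply: proper_card; apply/properP; split.
    by apply/subsetP => i; rewrite !inE => /andP[-> /eqP->]; rewrite andbF.
  exists q; rewrite !inE qN lq ?andbF //= (inj_eq Some_inj) eq_sym; exact: ab.
have /subsetPn[c] : ~~ (lset l (Some a) \subset N).
  case: lc => _ ca _ _; apply: contraTN (ca a) => sub.
  by rewrite -leqNgt -(setIidPr sub).
rewrite inE => /eqP lc' cN.
have cv : c != v by apply: contraPneq lv => <-; rewrite lc'.
have qc : q != c by apply: contraNneq cN => <-.
have [le|lt] := leP (x q) (x c).
  have [|||l' [N' [p1 p2 p3 p4 p5]]] := IH l (c |: (N :\ q)) _ _ lv _ amax.
  - apply: leq_trans ltm; apply: proper_card; apply/properP; split.
      apply/subsetP => i; rewrite !inE; case: (eqVneq i c) => [->|ic] /=.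
        by rewrite lc' eqxx.
      by case/and3P => -> _ ->.
    by exists q; rewrite !inE ?lq ?qN /= ?eqxx ?(negbTE qc) ?(inj_eq Some_inj) 1?eq_sym ?ab ?andbF.
  - exact: cut_labelling_replace.
  - apply/subsetP => i iD; have iN := subsetP cutN _ iD; rewrite !inE iN andbT.
    move: iD; rewrite !inE; case: (eqVneq i q) => [->|]; rewrite ?orbT //.
    by rewrite lq andbF.
  exists l', N'; split=> //; apply: le_trans p3.
  have vN' : v \notin c |: (N :\ q).
    by case: (cut_labelling_replace cv qN cN lc).
  case: (lc) => _ _ vN _; rewrite (quad_nbhd _ _ vN vN') sum_replace // lerDl.
  by rewrite mulr_ge0 // ?mulr_ge0 //; lra.
have [||||l' [N' [p1 p2 p3 p4 p5]]] := IH (label_swap l c q) N _ (cut_labelling_swap c q lc).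
- apply: leq_trans ltm; apply: proper_card; apply/properP; split.
    apply/subsetP => i; rewrite !inE; case: (eqVneq i c) => [->|ic].
      by rewrite (negbTE cN) andbF.
    case: (eqVneq i q) => [->|iq]; first by rewrite label_swap_r lc' eqxx.
    by rewrite label_swap_other.
  exists q; rewrite !inE ?label_swap_r ?lc' ?eqxx // lq qN /= (inj_eq Some_inj) eq_sym.
  by rewrite (negbTE ab).
- by rewrite label_swap_other // eq_sym.
- apply/subsetP => i iD; apply: (subsetP cutN); move: iD; rewrite !inE => /andP[->] /=.
  case: (eqVneq i c) => [->|ic]; first by rewrite label_swap_l lq.
  case: (eqVneq i q) => [->|iq]; first by rewrite label_swap_r lc'.
  by rewrite label_swap_other.
- move=> b'; have := amax b'; rewrite /label_swap !lsum_relabel // relabel_other //.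
  rewrite lc' lq !(inj_eq Some_inj) (eq_sym b a) (negbTE ab) eqxx.
  case: (eqVneq a b') => [<-|_]; first by rewrite (eq_sym b a) (negbTE ab); lra.
  by case: (eqVneq b b') => [<-|_]; lra.
exists l', N'; split=> //; apply: le_trans p3.
rewrite (quad_swap_block _ _ cv qv lc' lq ab) lerDl mulr_ge0 //.
  by rewrite mulr_ge0 // subr_ge0 ltW.
have := amax b; lra.
Qed.

(** After [fill_block], [v] exchanges labels with a vertex [u] of block [a]. The edges of [v] are
    unaffected, while [u] enters the cut and gains all other blocks. *)
Lemma special_leaves_cut l v N x : (forall i, 0 <= x i) -> cut_labelling l v N ->
  l v = None -> lset l None :\ v \subset N -> (k <= delta)%N ->
  exists l' N', [/\ cut_labelling l' v N', attached l' v N',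
    quad (block_graph l v N) x <= quad (block_graph l' v N') x
    & (forall i, 0 < x i) ->
      quad (block_graph l v N) x < quad (block_graph l' v N') x].
Proof.
move=> x0 lc lv cutN kd.
pose a0 : 'I_r := Ordinal (ltnW r2).
have [a _ amax] := @arg_maxP _ R 'I_r a0 xpredT (fun b => lsum l v x (Some b)) isT.
have [l1 [N1 [lc1 lv1 le1 cutN1 N1a]]] := fill_block x0 lc lv cutN (fun b => amax b isT).
(* Only [k - 1] cut vertices differ from [v], so [delta >= k] gives a neighbour in the block. Taking
   [u] different from [p] keeps [v] attached. *)
have [p pN1 lp] : exists2 p, p \in N1 & l1 p = Some a.
  have /subsetPn[p pN] : ~~ (N1 \subset lset l1 None :\ v).
    apply: contraTN kd => /subset_leq_card; case: lc1 => c0 _ _ ->.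
    by rewrite -c0 [in X in _ -> X](cardsD1 v) inE lv1 eqxx -ltnNge.
  rewrite !inE negb_and negbK => pv; exists p => //.
  have := subsetP N1a _ pN; rewrite !inE => /orP[lp|/eqP//].
  case: lc1 => _ _ vN _; move: pv; rewrite lp orbF => /eqP pv.
  by rewrite pv (negbTE vN) in pN.
have /subsetPn[u] : ~~ (lset l1 (Some a) \subset [set p]).
  case: lc1 => _ ca _ _; apply: contraTN (ca a) => /subset_leq_card.
  by rewrite cards1 -leqNgt => /leq_trans; apply.
rewrite !inE => /eqP lu up.
have uv : u != v by apply: contraPneq lv1 => <-; rewrite lu.
have gain : quad (block_graph (label_swap l1 u v) v N1) x = quad (block_graph l1 v N1) x +
    2 * x u * (tsum v x - lsum l1 v x None - lsum l1 v x (Some a)).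
  rewrite -(quad_block_cut _ _ uv lu); apply: quad_ext; apply: block_graph_label => i iv.
  by rewrite /label_swap relabel_other // lv1.
exists (label_swap l1 u v), N1; split.
- exact: cut_labelling_swap.
- exists a; rewrite label_swap_r; split=> // [i iN|].
    have iv : i != v by case: lc1 => _ _ vN _; apply: contraTneq iN => ->.
    have [->|iu] := eqVneq i u; first by rewrite label_swap_l; left.
    rewrite label_swap_other //; have := subsetP N1a _ iN.
    by rewrite !inE => /orP[] /eqP; [left|right].
  exists p => //; rewrite label_swap_other // 1?eq_sym //.
  by case: lc1 => _ _ vN _; apply: contraTneq pN1 => <-.
- apply: le_trans le1 _; rewrite gain lerDl mulr_ge0 ?other_blocks_ge0 //.
  by rewrite mulr_ge0.
move=> xp; apply: le_lt_trans le1 _; rewrite gain ltrDl mulr_gt0 //; first by rewrite mulr_gt0.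
have [b ab] := other_block a r2.
have [w lw] : exists w, l1 w = Some b.
  case: lc1 => _ ca _ _; have /set0Pn[w] : lset l1 (Some b) != set0.
    by rewrite -card_gt0; apply: leq_trans (ca b).
  by rewrite inE => /eqP; exists w.
have wv : w != v by apply: contraPneq lv1 => <-; rewrite lw.
have := tsum_ge l1 v x0 ab; have := lsum_ge x0 wv lw; have := xp w; lra.
Qed.

(* Here x must be an eigenvector: the edge of the special vertex to the cut that is lost is paid for by the edges gained by the new cut vertex u. *)
Lemma special_leaves_cut_small l v N x rho : (forall i, 0 < x i) ->
  (forall i, nbsum (block_graph l v N) x i = rho * x i) ->
  cut_labelling l v N -> l v = None -> N \subset lset l None ->
  exists l' N', [/\ cut_labelling l' v N', attached l' v N'
    & quad (block_graph l v N) x < quad (block_graph l' v N') x].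
Proof.
move=> xp xE lc lv Ncut; have x0 i : 0 <= x i := ltW (xp i).
pose a0 : 'I_r := Ordinal (ltnW r2); have [b0 ab0] := other_block a0 r2.
(* Block [a] is the lighter one, so the weight [O] outside it and the cut is at least its own. From
   it [u] will enter the cut, and [t] will replace [d] as a neighbour of [v]. *)
have [a [b [ab Fab]]] : exists a b : 'I_r, a != b /\
    lsum l v x (Some a) <= lsum l v x (Some b).
  have [le|/ltW le] := leP (lsum l v x (Some a0)) (lsum l v x (Some b0)).
    by exists a0, b0.
  by exists b0, a0; rewrite eq_sym.
have /card_gt1P [u [t [lu lt ut]]] : (1 < #|lset l (Some a)|)%N.
  by case: lc => _ ca _ _; apply: leq_trans (ca a).
move: lu lt; rewrite !inE => /eqP lu /eqP lt.
have sv i c : l i = Some c -> i != v by move=> li; apply: contraPneq lv => <-; rewrite li.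
have sN i c : l i = Some c -> i \notin N.
  by move=> li; apply/negP => /(subsetP Ncut); rewrite inE li.
have uv := sv _ _ lu; have tv := sv _ _ lt.
have [vN cN] : v \notin N /\ #|N| = delta by case: lc.
have /card_gt0P[d dN] : (0 < #|N|)%N by rewrite cN.
have ld : l d = None by apply/eqP; move: (subsetP Ncut _ dN); rewrite inE.
have dv : d != v by apply: contraNneq vN => <-.
have td : t != d by apply: contraPneq ld => <-; rewrite lt.
have ud : u != d by apply: contraPneq ld => <-; rewrite lu.
have tN := sN _ _ lt.
have equ := nbsum_block N x uv lu; have eqt := nbsum_block N x tv lt.
have eqd := nbsum_cut N x dv ld; have eqv := nbsum_special l x vN.
rewrite !xE (negbTE (sN _ _ lu)) (negbTE (sN _ _ lt)) dN in equ eqt eqd eqv.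
have NS : \sum_(j in N) x j <= lsum l v x None.
  rewrite /lsum big_mkcond [leRHS]big_mkcond; apply: ler_sum => i _.
  case: (boolP (i \in N)) => [iN|_]; last by case: ifP.
  have := subsetP Ncut _ iN; rewrite inE => ->; rewrite andbT.
  by case: eqVneq => // iv; rewrite -iv iN in vN.
have dS : x d <= lsum l v x None by apply: lsum_ge.
have uF : x u + x t <= lsum l v x (Some a) by apply: lsum_ge2 => //; rewrite eq_sym.
have T := tsum_ge l v x0 ab.
set S0 := lsum l v x None in equ eqt eqd NS dS T *.
set Fa := lsum l v x (Some a) in equ eqt Fab uF T *.
set Fb := lsum l v x (Some b) in Fab T *.
set O := tsum v x - S0 - Fa.
have xu := xp u; have xt := xp t; have xd := xp d; have xv := xp v.
have rho_u : 0 < rho * x u by lra.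
have rho0 : 0 < rho by rewrite pmulr_lgt0 in rho_u.
have xut : x t = x u by apply: (mulfI (_ : rho + 1 != 0)); [apply: lt0r_neq0; lra|lra].
have rho1 : 1 < rho by rewrite -(ltr_pM2r xu); lra.
have xvu : x v <= x u by rewrite -(ler_pM2l rho0); lra.
have OE : (rho + 1) * (x d - x u) = x v + O by rewrite /O; lra.
have Ou : x u <= O by rewrite /O; lra.
(* By [OE] the difference is [(x v + O) / (rho + 1)], where [x v <= x u <= O] and [rho > 1]. *)
have dO : x d - x u < O.
  rewrite -(@ltr_pM2l _ (rho + 1)); last by lra.
  rewrite OE; have : 0 < (rho - 1) * O by apply: mulr_gt0; lra.
  lra.
pose N' := t |: (N :\ d).
have lcN' : cut_labelling l v N' by exact: cut_labelling_replace.
have vN' : v \notin N' by case: lcN'.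
have Eq : block_graph (label_swap l u v) v N' =2 block_graph (relabel l u None) v N'.
  by apply: block_graph_label => i iv; rewrite /label_swap relabel_other // lv.
exists (label_swap l u v), N'; split.
- exact: cut_labelling_swap.
- exists a; rewrite label_swap_r; split=> // [i|].
    rewrite !inE => /orP[/eqP->|/andP[_ iN]].
      by right; rewrite label_swap_other // eq_sym.
    have iv : i != v by apply: contraNneq vN => <-.
    have [->|iu] := eqVneq i u; first by left; rewrite label_swap_l.
    left; rewrite label_swap_other //.
    by apply/eqP; move: (subsetP Ncut _ iN); rewrite inE.
  by exists t; [rewrite !inE eqxx|rewrite label_swap_other // eq_sym].
rewrite (quad_ext _ Eq) (quad_block_cut _ _ uv lu) (quad_nbhd _ _ vN vN') sum_replace //.
rewrite -/S0 -/Fa -/O xut.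
have : 0 < x v * (O - (x d - x u)) by apply: mulr_gt0; lra.
have : 0 <= (x u - x v) * O by apply: mulr_ge0; lra.
lra.
Qed.

End Reduction.

(** * The block graph of a cut *)

Section Embedding.
Variables (n r k h0 delta : nat) (G : rel 'I_n) (S : {set 'I_n}) (v : 'I_n).
Hypotheses (h01 : 1 <= h0) (r0 : 0 < r) (Gs : simple_graph G) (Scut : hr_cut G r h0 S)
  (cS : #|S| = k) (dv : deg G v = delta) (dmin : forall u, delta <= deg G u).

Let h := maxn h0 (delta - k).
Let comp x : {set 'I_n} := [set y | connect (del_rel G S) x y].

Lemma del_rel_connect_sym : connect_sym (del_rel G S).
Proof.
apply: sym_connect_sym => x y; rewrite /del_rel; case: Gs => sG _.
by rewrite sG andbCA.
Qed.

Lemma comp_eq x y : connect (del_rel G S) x y -> comp x = comp y.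
Proof.
move=> xy; apply/setP => z; rewrite !inE.
exact: (same_connect del_rel_connect_sym).
Qed.

Lemma connect_notin x y : x \notin S -> connect (del_rel G S) x y -> y \notin S.
Proof.
move=> xS /connectP[p]; elim: p x xS => [|z p IH] x xS /=; first by move=> _ ->.
by case/andP => /and3P[_ zS _]; exact: IH.
Qed.

Lemma min_lt_r m : minn m r.-1 < r.
Proof. by rewrite -{2}(prednK r0) ltnS geq_minr. Qed.

(** Components are numbered by their position in an enumeration; all from the last index on are
    merged into one block, which can only add edges in the block graph. *)
Definition comp_label : {ffun 'I_n -> option 'I_r} :=
  [ffun x => if x \in S then None else
     Some (Ordinal (min_lt_r (index (comp x) (enum (components G S)))))].

Lemma comp_label_eq x y : x \notin S -> connect (del_rel G S) x y ->
  comp_label x = comp_label y.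
Proof.
move=> xS xy; have yS := connect_notin xS xy.
rewrite !ffunE (negbTE xS) (negbTE yS); congr Some; apply: val_inj => /=.
by rewrite (comp_eq xy).
Qed.

Lemma comp_label_cut x : (comp_label x == None) = (x \in S).
Proof. by rewrite ffunE; case: ifP. Qed.

(** A vertex outside [S] has at most [k] neighbours in [S], so at least [delta - k] in its own
    component. *)
Lemma comp_size x : x \notin S -> h < #|comp x|.
Proof.
move=> xS; case: Scut => _ [_ big]; rewrite /h gtn_max big ?imset_f ?inE //=.
have sub : [set u | G x u] \subset S :|: (comp x :\ x).
  apply/subsetP => u; rewrite !inE => xu; case: (boolP (u \in S)) => //= uS.
  case: Gs => _ iG; rewrite connect1 /del_rel ?xS ?uS // andbT.
  by apply: contraTneq xu => ->; rewrite iG.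
have := leq_trans (dmin x) (subset_leq_card sub); rewrite cardsU cS.
have := cardsD1 x (comp x); rewrite inE connect0 add1n => E le; rewrite E ltnS leq_subLR; exact: leq_trans le (leq_subr _ _).
Qed.

Lemma cut_embedding : exists l : {ffun 'I_n -> option 'I_r},
  [/\ cut_labelling k h delta l v [set u | G v u],
    forall i j, G i j -> block_graph l v [set u | G v u] i j
    & l v = None \/ attached l v [set u | G v u]].
Proof.
have [sG iG] := Gs.
have lE i j : i \notin S -> j \notin S -> G i j -> comp_label i = comp_label j.
  move=> iS jS ij; apply: comp_label_eq => //; apply: connect1.
  by rewrite /del_rel iS jS ij.
exists comp_label; split.
- split.
  + by rewrite -cS; apply: eq_card => i; rewrite inE comp_label_cut.
  + move=> a; case: Scut => _ [rP big].
    have aP : a < #|components G S| by apply: leq_trans (ltn_ord a) rP.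
    have aP' : a < size (enum (components G S)) by rewrite -cardE.
    have : nth set0 (enum (components G S)) a \in components G S.
      by rewrite -mem_enum mem_nth.
    case/imsetP => x; rewrite inE => xS xC.
    apply: leq_trans (comp_size xS) _; apply: subset_leq_card; apply/subsetP => y.
    rewrite inE => xy; rewrite inE -(comp_label_eq xS xy) ffunE (negbTE xS).
    apply/eqP; congr Some; apply: val_inj => /=.
    rewrite -[comp x]xC index_uniq ?enum_uniq //; apply/minn_idPl.
    by rewrite -ltnS prednK.
  + by rewrite inE iG.
  + exact: dv.
- move=> i j ij; have ne : i != j by apply: contraTneq ij => ->; rewrite iG.
  rewrite /block_graph ne /=; case: (eqVneq i v) => [<-|iv]; first by rewrite inE.
  case: (eqVneq j v) => [<-|jv]; first by rewrite inE sG.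
  rewrite !comp_label_cut; case: (boolP (i \in S)) => //= iS.
  by case: (boolP (j \in S)) => //= jS; rewrite (lE i j) ?eqxx.
have [vS|vS] := boolP (v \in S); first by left; apply/eqP; rewrite comp_label_cut.
right; case lv : (comp_label v) => [a|]; last first.
  by move/eqP: lv; rewrite comp_label_cut (negbTE vS).
exists a; split=> // [i|].
  rewrite inE => vi; have [iS|iS] := boolP (i \in S).
    by left; apply/eqP; rewrite comp_label_cut.
  by right; rewrite -(lE v i).
(* The component of [v] has a second vertex; the first edge of a path to it gives a neighbour of [v]
   in its block. *)
have [|y yC yv] := @subsetPn _ (comp v) [set v] _.
  apply: contraTN (comp_size vS) => /subset_leq_card; rewrite cards1 -leqNgt.
  move=> /leq_trans; apply; rewrite /h; lia.
move: yC; rewrite inE => /connectP[[|z p] /=]; first by move=> _ yE; rewrite inE yE eqxx in yv.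
case/andP => /and3P[_ zS vz] _ _; exists z; first by rewrite inE.
by rewrite -(lE v z).
Qed.

End Embedding.

(** * Extremal labellings *)

Lemma same_count_perm (n : nat) (T : finType) (f g : 'I_n -> T) :
  (forall t, #|[set i | f i == t]| = #|[set i | g i == t]|) ->
  exists p : {perm 'I_n}, forall i, f i = g (p i).
Proof.
move=> E; have /tuple_permP[p fp] : perm_eq [tuple f i | i < n] [tuple g i | i < n].
  apply/allP => t _ /=.
  have W (u : 'I_n -> T) : count_mem t [tuple u i | i < n] = #|[set i | u i == t]|.
    rewrite /= count_map -sum1_count -sum1_card big_enum_cond.
    by apply: eq_bigl => i; rewrite inE.
  by rewrite !W E.
exists p => i; move/(congr1 (fun s => nth (f i) s i)): fp.
by rewrite -!tnth_nth !tnth_mktuple.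
Qed.

Lemma perm_two_points (T : finType) (a b a' b' : T) : a != b -> a' != b' ->
  exists s : {perm T}, s a = a' /\ s b = b'.
Proof.
move=> ab ab'; exists (tperm a a' * tperm (tperm a a' b) b')%g.
rewrite !permM tpermL tpermL; split=> //.
by rewrite tpermD // 1?eq_sym // -{1}(tpermL a a') (inj_eq perm_inj).
Qed.

Section Extremal.
Variables (n r k h delta : nat).
Implicit Types (l : {ffun 'I_n -> option 'I_r}) (v : 'I_n) (N : {set 'I_n}).

(** [a1] is the block that absorbs the vertices in excess; it differs from the block [a0] of [v]. *)
Definition extremal l v N a0 a1 : Prop :=
  [/\ cut_labelling k h delta l v N, l v = Some a0,
    forall i, i \in N -> l i = None \/ l i = Some a0,
    #|N :&: lset l None| = minn delta.-1 k
    & a0 != a1 /\ forall a, a != a1 -> #|lset l (Some a)| = h.+1].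

Lemma card_labels l : n = #|lset l None| + \sum_a #|lset l (Some a)|.
Proof.
rewrite -[LHS]card_ord -[LHS]sum1_card (partition_big l xpredT) //= (bigD1 None) //=.
congr (_ + _); first by rewrite -sum1_card; apply: eq_bigl => i; rewrite inE.
rewrite (reindex_omap Some id) /=; last by case.
by apply: eq_big => [a|a _]; rewrite ?eqxx // -sum1_card; apply: eq_bigl => i; rewrite inE.
Qed.

(** Adjacency of distinct vertices in the block graph depends only on their signatures. *)
Definition signature l v N i := (l i, i == v, i \in N).

(** Block [a0] consists of [v], of [delta - m] neighbours and of the rest of its [h + 1] vertices;
    [a1] takes what the cut and the other blocks leave. *)
Definition signature_count (a0 a1 : 'I_r) (c : option 'I_r * bool * bool) : nat :=
  let m := minn delta.-1 k in
  match c with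
  | (None, b1, b2) => if b1 then 0 else if b2 then m else k - m
  | (Some a, b1, b2) =>
    if a == a0 then if b1 then (~~ b2 : nat) else if b2 then delta - m else h - (delta - m)
    else if b1 || b2 then 0 else if a == a1 then n - k - r.-1 * h.+1 else h.+1
  end.

Lemma signature_countP l v N a0 a1 c : extremal l v N a0 a1 ->
  #|[set i | signature l v N i == c]| = signature_count a0 a1 c.
Proof.
move=> [[c0 ca vN cN] lv N0 Nm [a01 a1P]].
have N0None : #|N :\: lset l None| = delta - minn delta.-1 k.
  by rewrite cardsD Nm cN.
have NDE : N :\: lset l None = N :&: lset l (Some a0).
  apply/setP => i; rewrite !inE andbC; case: (boolP (i \in N)) => //= /N0.
  by case=> ->; rewrite eqxx.
have set_eq (A : {set 'I_n}) (P : pred 'I_n) : (forall i, P i = (i \in A)) ->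
    #|[set i | P i]| = #|A|.
  by move=> E; apply: eq_card => i; rewrite inE E.
have cut_v i : l i = None -> i != v by move=> li; apply: contraPneq li => ->; rewrite lv.
case: c => [[[a|] b1] b2] /=; rewrite /signature.
- case: eqVneq => [->|aa0].
    case: b1 => /=.
      case: b2 => /=.
        apply: eq_card0 => i; rewrite inE !xpair_eqE; apply/negP.
        by move=> /andP[/andP[_]]; rewrite !eqb_id => /eqP->; rewrite (negbTE vN).
      rewrite (set_eq [set v]) ?cards1 // => i; rewrite inE !xpair_eqE eqb_id eqbF_neg.
      by case: (eqVneq i v) => [->|]; rewrite ?andbF // lv eqxx vN.
    case: b2.
      rewrite -N0None NDE; apply: set_eq => i; rewrite !inE !xpair_eqE eqb_id eqbF_neg.
      case: (boolP (i \in N)) => iN; rewrite ?andbF // andbT.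
      by have -> : i != v by [apply: contraNneq vN => <-]; rewrite andbT.
    have -> : h - (delta - minn delta.-1 k) = #|(lset l (Some a0) :\ v) :\: N|.
      rewrite cardsD setIC setIDA -NDE.
      have -> : (N :\: lset l None) :\ v = N :\: lset l None.
        apply/setP => i; rewrite !inE; case: eqVneq => [->|//].
        by rewrite (negbTE vN) andbF.
      rewrite N0None; congr (_ - _).
      by have := cardsD1 v (lset l (Some a0)); rewrite a1P // inE lv eqxx add1n => -[].
    apply: set_eq => i; rewrite !inE !xpair_eqE !eqbF_neg.
    by case: (i \in N); rewrite ?andbF //= andbT andbC.
  have la i : l i = Some a -> i != v /\ i \notin N.
    move=> li; split; first by apply: contra_neq aa0 => E; move: li; rewrite E lv => -[].
    by apply: contra_neqN aa0 => /N0; rewrite li => -[//|[]].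
  case: ifP => [b12|/norP[/negbTE-> /negbTE->]].
    apply: eq_card0 => i; rewrite inE !xpair_eqE; apply/negP => /andP[/andP[/eqP/la[iv iN]]].
    rewrite (negbTE iv) (negbTE iN) => /eqP e1 /eqP e2.
    by rewrite -e1 -e2 in b12.
  have -> : #|[set i | (l i, i == v, i \in N) == (Some a, false, false)]| = #|lset l (Some a)|.
    apply: set_eq => i; rewrite !inE !xpair_eqE !eqbF_neg.
    by case: eqVneq => //= /la[-> ->].
  case: eqVneq => [->|]; last exact: a1P.
  rewrite [in RHS](card_labels l) c0 addKn (bigD1 a1) //=.
  rewrite (eq_bigr (fun=> h.+1)); last by move=> i; exact: a1P.
  by rewrite sum_nat_const cardC1 card_ord addnK.
- case: b1.
    apply: eq_card0 => i; rewrite inE !xpair_eqE; apply/negP.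
    by move=> /andP[/andP[/eqP /cut_v]]; rewrite eqb_id => /negbTE->.
  case: b2.
    rewrite -Nm; apply: set_eq => i; rewrite !inE !xpair_eqE eqbF_neg eqb_id.
    by case: eqVneq => [/cut_v->|]; rewrite ?andbF //= andbT.
  rewrite -[in RHS]Nm -c0 setIC -cardsD; apply: set_eq => i.
  rewrite !inE !xpair_eqE !eqbF_neg.
  by case: eqVneq => [/cut_v->|]; rewrite ?andbF //= andbT.
Qed.

Lemma signature_count_perm a0 a1 a0' a1' (s : {perm 'I_r}) c b1 b2 :
  s a0 = a0' -> s a1 = a1' ->
  signature_count a0' a1' (omap s c, b1, b2) = signature_count a0 a1 (c, b1, b2).
Proof. by move=> <- <-; case: c => //= a; rewrite !(inj_eq perm_inj). Qed.

(** A permutation of the blocks aligns the distinguished pairs; equal signature counts then give a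
    vertex bijection preserving signatures, hence adjacency. *)
Lemma extremal_iso l v N a0 a1 l' v' N' a0' a1' :
  extremal l v N a0 a1 -> extremal l' v' N' a0' a1' ->
  isomorphic (block_graph l v N) (block_graph l' v' N').
Proof.
move=> ex ex'.
have [s [s0 s1]] : exists s : {perm 'I_r}, s a0 = a0' /\ s a1 = a1'.
  by case: ex => _ _ _ _ [ne _]; case: ex' => _ _ _ _ [ne' _]; exact: perm_two_points.
pose f i := (omap s (l i), i == v, i \in N).
have [p pE] : exists p : {perm 'I_n}, forall i, f i = signature l' v' N' (p i).
  apply: same_count_perm => -[[c b1] b2].
  have [c' ->] : exists c', c = omap s c'.
    case: c => [a|]; last by exists None.
    by exists (Some ((s^-1)%g a)); rewrite /= permKV.
  rewrite (signature_countP _ ex') (signature_count_perm _ _ _ s0 s1).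
  rewrite -(signature_countP _ ex); apply: eq_card => i; rewrite !inE /f !xpair_eqE.
  congr (_ && _ && _); apply/eqP/eqP => [|->//].
  by case: (l i) => [a|]; case: c' => //= b [/perm_inj->].
exists p; split; first by exists (p^-1)%g; [exact: permK|exact: permKV].
move=> i j; rewrite /block_graph (inj_eq perm_inj); case: eqVneq => //= ij.
have [li iv iN] := pE i; have [lj jv jN] := pE j.
rewrite -iv -iN -jv -jN; case: eqVneq => // _; case: eqVneq => // _.
rewrite -li -lj; case: (l i) => [a|] //; case: (l j) => [b|] //=.
by rewrite !(inj_eq Some_inj) (inj_eq perm_inj).
Qed.

End Extremal.

(** * The graph Gext *)

Lemma card_interval (n lo hi : nat) : hi <= n ->
  #|[set i : 'I_n | lo <= i < hi]| = hi - lo.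
Proof.
move=> le; rewrite -sum1_card (eq_bigl (fun i : 'I_n => lo <= i < hi)); last first.
  by move=> i; rewrite inE.
rewrite -(big_mkord (fun i => lo <= i < hi) (fun=> 1)).
rewrite (eq_bigl (fun i => (lo <= i) && (i < hi))) // -big_nat_widen //.
rewrite -(big_nat_widenl lo 0 hi xpredT) //.
by rewrite sum_nat_const_nat muln1.
Qed.

Section Gext.
Variables (n r k h0 delta : nat).
Let h := maxn h0 (delta - k).
Hypotheses (r2 : 2 <= r) (h01 : 1 <= h0) (k1 : 1 <= k) (d1 : 1 <= delta)
  (kn : k + r * h.+1 <= n).

Let a := n - k - r.-1 * h.+1.
Let kh0 := k + a + r.-2 * h.+1.

Lemma big_block : h < a.
Proof. by move: kn; rewrite /a -{1}(ltn_predK r2) mulSn; lia. Qed.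

Lemma order_split : n = k + a + r.-1 * h.+1.
Proof. by move: kn; rewrite /a -{1}(ltn_predK r2) mulSn; lia. Qed.

Lemma last_block : n = (kh0 + h).+1.
Proof.
rewrite /kh0 {1}order_split -[in LHS](ltn_predK (_ : 0 < r.-1)) ?mulSn; last by lia.
by lia.
Qed.

Lemma special_proof : n.-1 < n.
Proof. by have := last_block; lia. Qed.

Definition Gext_special : 'I_n := Ordinal special_proof.

(** The truncation in [min_lt_r] serves to build an ordinal; by [blk_lt] it does not change the
    block number. *)
Definition Gext_label : {ffun 'I_n -> option 'I_r} :=
  [ffun i : 'I_n => if i < k then None
    else Some (Ordinal (min_lt_r (ltnW r2) (blk (k + a) h.+1 i)))].

Definition Gext_nbhd : {set 'I_n} := [set z : 'I_n |
  if delta <= k then (z < delta - 1) || (z == kh0 :> nat)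
  else (z < k) || ((kh0 <= z) && (z < kh0 + (delta - k)))].

Lemma blk_lt (i : 'I_n) : blk (k + a) h.+1 i < r.
Proof.
rewrite /blk; case: (ltnP i (k + a)) => ik; first exact: ltnW r2.
rewrite addn1 -ltn_predRL ltn_divLR //.
by have := ltn_ord i; have := order_split; lia.
Qed.

Lemma Gext_label_cut (i : 'I_n) : (Gext_label i == None) = (i < k).
Proof. by rewrite ffunE; case: ifP. Qed.

Lemma Gext_label_eq (i j : 'I_n) : k <= i -> k <= j ->
  (Gext_label i == Gext_label j) = (blk (k + a) h.+1 i == blk (k + a) h.+1 j).
Proof.
move=> ki kj; rewrite !ffunE !ltnNge ki kj /= (inj_eq Some_inj) -val_eqE /=.
have W (u : 'I_n) : minn (blk (k + a) h.+1 u) r.-1 = blk (k + a) h.+1 u.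
  by apply/minn_idPl; have := blk_lt u; lia.
by rewrite !W.
Qed.

Lemma Gext_label_block (i : 'I_n) (b : 'I_r) :
  (Gext_label i == Some b) = (k <= i) && (blk (k + a) h.+1 i == b :> nat).
Proof.
rewrite ffunE ltnNge; case: (leqP k i) => //= ki.
rewrite (inj_eq Some_inj) -val_eqE /=; congr (_ == _).
by apply/minn_idPl; have := blk_lt i; lia.
Qed.

Lemma blk_succ u t : (blk (k + a) h.+1 u == t.+1) =
  (k + a + t * h.+1 <= u < k + a + t.+1 * h.+1).
Proof.
rewrite /blk; case: ltnP => ua; first by apply/esym/negbTE; rewrite negb_and; lia.
rewrite addn1 eqSS eqn_leq -ltnS ltn_divLR // leq_divRL // andbC.
by rewrite -{3 4}(subnKC ua) -!addnA !leq_add2l !ltn_add2l.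
Qed.

Lemma blk_zero u : (blk (k + a) h.+1 u == 0) = (u < k + a).
Proof. by rewrite /blk; case: ltnP => //; rewrite addn1. Qed.

Lemma Gext_block_zero (b : 'I_r) : b = 0 :> nat ->
  lset Gext_label (Some b) = [set i : 'I_n | k <= i < k + a].
Proof.
by move=> b0; apply/setP => i; rewrite !inE Gext_label_block b0 blk_zero.
Qed.

Lemma Gext_block_succ (b : 'I_r) t : b = t.+1 :> nat -> lset Gext_label (Some b) =
  [set i : 'I_n | k + a + t * h.+1 <= i < k + a + t.+1 * h.+1].
Proof.
move=> bt; apply/setP => i; rewrite !inE Gext_label_block bt blk_succ.
by case: (leqP k i) => //= ki; apply/esym/negbTE; rewrite negb_and; lia.
Qed.

Lemma Gext_card_zero (b : 'I_r) : b = 0 :> nat -> #|lset Gext_label (Some b)| = a.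
Proof.
by move=> b0; rewrite Gext_block_zero // card_interval ?addKn // order_split leq_addr.
Qed.

Lemma Gext_card_succ (b : 'I_r) t : b = t.+1 :> nat ->
  #|lset Gext_label (Some b)| = h.+1.
Proof.
move=> bt; rewrite (Gext_block_succ bt) card_interval; first by rewrite mulSn; lia.
rewrite [n in _ <= n]order_split leq_add2l leq_mul2r; have := ltn_ord b; lia.
Qed.

Lemma Gext_extremal : exists a0 a1,
  extremal k h delta Gext_label Gext_special Gext_nbhd a0 a1.
Proof.
have lr : r.-1 < r by lia.
(* [a0] is the last block, formed by the clique on [h] vertices and the vertex [n - 1]; [a1] is the
   initial block of size [a]. *)
pose a0 : 'I_r := Ordinal lr; pose a1 : 'I_r := Ordinal (ltnW r2).
have nE := last_block; have [dk hk] : delta <= k + h /\ (delta - k <= h) by rewrite /h; lia.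
have ah := big_block.
have kk : k < kh0 by rewrite /kh0; apply: leq_trans (leq_addr _ _); lia.
have a0E : lset Gext_label (Some a0) = [set i : 'I_n | kh0 <= i < n].
  rewrite (@Gext_block_succ _ r.-2) /=; last by lia.
  apply/setP => i; rewrite !inE -/kh0; congr (_ && (_ < _)).
  by rewrite [RHS]order_split; congr (_ + _ * _); lia.
have cutE : lset Gext_label None = [set i : 'I_n | 0 <= i < k].
  by apply/setP => i; rewrite !inE Gext_label_cut.
have NcE : Gext_nbhd :&: lset Gext_label None = [set i : 'I_n | 0 <= i < minn delta.-1 k].
  apply/setP => i; rewrite cutE !inE /=; case: (leqP delta k) => kd; lia.
have NaE : Gext_nbhd :&: lset Gext_label (Some a0) =
    [set i : 'I_n | kh0 <= i < kh0 + (delta - minn delta.-1 k)].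
  by apply/setP => i; rewrite a0E !inE /=; case: (leqP delta k) => kd; lia.
have N0 i : i \in Gext_nbhd -> Gext_label i = None \/ Gext_label i = Some a0.
  move=> iN; have : (i \in lset Gext_label None) || (i \in lset Gext_label (Some a0)).
    rewrite cutE a0E; move: iN; rewrite !inE; have := ltn_ord i.
    by case: (leqP delta k) => kd; lia.
  by rewrite !inE => /orP[] /eqP; [left|right].
have NDE : Gext_nbhd :\: lset Gext_label None = Gext_nbhd :&: lset Gext_label (Some a0).
  apply/setP => i; rewrite in_setD in_setI ![i \in lset _ _]in_set.
  by case: (boolP (i \in Gext_nbhd)) => [/N0[] ->|_]; rewrite ?eqxx ?andbF.
have cN : #|Gext_nbhd :&: lset Gext_label None| = minn delta.-1 k.
  by rewrite NcE card_interval ?subn0 //; lia.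
exists a0, a1; split=> //.
- split.
  + by rewrite cutE card_interval ?subn0 //; lia.
  + move=> b; case E : (val b) => [|t]; first by rewrite Gext_card_zero.
    by rewrite (Gext_card_succ E).
  + by rewrite inE /=; case: (leqP delta k) => kd; lia.
  + rewrite -(cardsID (lset Gext_label None)) NDE NaE cN card_interval; lia.
- have : Gext_special \in lset Gext_label (Some a0) by rewrite a0E inE /=; lia.
  by rewrite [_ \in _]in_set => /eqP.
split; first by rewrite -val_eqE /=; lia.
move=> b ba; case E : (val b) => [|t]; last by rewrite (Gext_card_succ E).
by move: ba; rewrite -val_eqE E.
Qed.

(** For [delta < k + h0] the maximum [h] equals [h0] and the layouts agree. Otherwise
    [h = delta - k], and [Gext_nbhd] is the cut together with the rest of the last block, so [n - 1]
    is an ordinary vertex of a clique. *)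
Lemma GextE : Gext n k r h0 delta =2 block_graph Gext_label Gext_special Gext_nbhd.
Proof.
move=> i j; rewrite /Gext /block_graph.
have nE := last_block; have nE' := order_split; have ah := big_block.
have kk : k < kh0 by rewrite /kh0; apply: leq_trans (leq_addr _ _); lia.
have lab : [|| Gext_label i == None, Gext_label j == None | Gext_label i == Gext_label j]
  = [|| i < k, j < k | blk (k + a) h.+1 i == blk (k + a) h.+1 j].
  rewrite !Gext_label_cut; case: (ltnP i k) => //= ki; case: (ltnP j k) => //= kj.
  by rewrite Gext_label_eq.
rewrite lab !inE -!val_eqE /= !subn1.
case: (leqP (k + h0) delta) => hd; last first.
  have hE : h = h0 by rewrite /h; lia.
  have -> : n - k - r.-1 * h0.+1 = a by rewrite -hE.
  by rewrite -hE subn2.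
have hE : h.+1 = delta - k + 1 by rewrite /h; lia.
rewrite -hE -/a; case: (eqVneq (i : nat) j) => //= ij.
have dk : (delta <= k) = false by lia.
have kh : kh0 + (delta - k) = n.-1 by lia.
have adj (u w : 'I_n) : w = n.-1 :> nat -> u != w :> nat ->
    [|| w < k, u < k | blk (k + a) h.+1 w == blk (k + a) h.+1 u] =
    (u < k) || (kh0 <= u < n.-1).
  move=> wE uw; have -> : (w < k) = false by lia.
  have -> : blk (k + a) h.+1 w = r.-2.+1.
    apply/eqP; rewrite blk_succ -/kh0 mulSn addnCA addnA -/kh0 addnC.
    by lia.
  rewrite eq_sym blk_succ -/kh0 mulSn [h.+1 + _]addnC addnA -/kh0 /=; congr (_ || _).
  by have := ltn_ord u; lia.
rewrite dk kh; case: (eqVneq (i : nat) n.-1) => [iw|iw]; first by rewrite (adj j i) // eq_sym.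
case: (eqVneq (j : nat) n.-1) => [jw|jw] //; rewrite -(adj i j) // orbCA.
by congr [|| _, _ | _]; rewrite eq_sym.
Qed.

End Gext.

(** * Comparison of spectral radii *)

Section Comparison.
Local Open Scope ring_scope.
Variables (R : realType) (n r k h delta : nat).
Implicit Types (l : {ffun 'I_n -> option 'I_r}) (v : 'I_n) (N : {set 'I_n}).
Hypotheses (k1 : (1 <= k)%N) (h1 : (1 <= h)%N) (r2 : (1 < r)%N)
  (d1 : (1 <= delta)%N) (dkh : (delta <= k + h)%N).

Local Notation in_class l v N := (cut_labelling k h delta l v N /\ attached l v N).

Lemma in_class_connected l v N : in_class l v N ->
  forall i j, connect (block_graph l v N) i j.
Proof.
by move=> [lc [a [lv _ [t tN _]]]]; apply: (class_connected k1 lc lv); exists t.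
Qed.

Lemma maximal_extremal l v N (rho : R) : in_class l v N ->
    is_top (block_graph l v N) rho ->
    (forall l' v' N' rho', in_class l' v' N' -> is_top (block_graph l' v' N') rho' ->
       rho' <= rho) ->
  exists a0 a1, extremal k h delta l v N a0 a1.
Proof.
move=> lcl top max; have sB := block_graph_sym l v N.
have [x [x0 xn xE]] := is_top_nonneg sB top.
have xp := nonneg_eigen_gt0 (in_class_connected lcl) x0 xn xE.
have maxx l' v' N' : cut_labelling k h delta l' v' N' -> attached l' v' N' ->
    quad (block_graph l' v' N') x <= quad (block_graph l v N) x /\
    (quad (block_graph l' v' N') x = quad (block_graph l v N) x ->
     forall i, nbsum (block_graph l' v' N') x i = nbsum (block_graph l v N) x i).
  move=> lc' at'; have sB' := block_graph_sym l' v' N'.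
  have cl' : in_class l' v' N' by split.
  have n0 : (0 < n)%N by apply: leq_ltn_trans (ltn_ord v).
  have [rho' top'] := is_top_exists R n0 sB'; have le' := max _ _ _ _ cl' top'.
  have step le0 := top_step sB' (in_class_connected cl') top' x0 xn xE le0.
  (* If the form does not drop, [top_step] gives [rho <= rho']; with [rho' <= rho] its equality case
     applies. *)
  have bound : quad (block_graph l v N) x <= quad (block_graph l' v' N') x ->
      quad (block_graph l' v' N') x = quad (block_graph l v N) x /\
      forall i, nbsum (block_graph l' v' N') x i = nbsum (block_graph l v N) x i.
    by move=> /step[le /(_ (le_anti (introT andP (conj le le'))))[]].
  split; last by move=> E; apply: (bound _).2; rewrite E.
  by rewrite leNgt; apply/negP => lt; have [E _] := bound (ltW lt); rewrite E ltxx in lt.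
have [lc [a0 [lv N0 Nt]]] := lcl; have [c0 ca vN cN] := lc.
have full := max_cut_full r2 lc lv N0 xp maxx.
have small := max_special_block k1 h1 r2 dkh lc lv N0 Nt xp xE maxx.
have one := max_one_large h1 r2 dkh lc lv N0 Nt xp maxx.
have small0 : #|lset l (Some a0)| = h.+1 by apply/eqP; rewrite eqn_leq small ca.
have [a1 a01 a1P] : exists2 a1, a0 != a1 & forall a, a != a1 -> #|lset l (Some a)| = h.+1.
  have [[b hb]|none] := pselect (exists b, (h.+1 < #|lset l (Some b)|)%N).
    exists b; first by apply: contraTneq hb => <-; rewrite small0 ltnn.
    move=> a ab; apply/eqP; rewrite eqn_leq ca andbT.
    by apply: (one b) => //; rewrite eq_sym.
  have [b ab] := other_block a0 r2; exists b => // a _.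
  apply/eqP; rewrite eqn_leq ca andbT leqNgt; apply/negP => ha.
  by case: none; exists a.
exists a0, a1; split=> //.
have split_N : (#|N :&: lset l None| + #|N :&: lset l (Some a0)|)%N = delta.
  rewrite -cN -(cardsID (lset l None) N); congr addn; apply: eq_card => i.
  rewrite in_setD in_setI ![_ \in lset _ _]in_set.
  by case: (boolP (i \in N)) => [/N0[] ->|_]; rewrite ?eqxx ?andbF.
have j1 : (0 < #|N :&: lset l (Some a0)|)%N.
  by have [t tN lt] := Nt; apply/card_gt0P; exists t; rewrite !inE tN lt eqxx.
have lek : (#|N :&: lset l None| <= k)%N by rewrite -c0 subset_leq_card ?subsetIr.
(* One neighbour in the block leaves [delta - 1 <= k] in the cut; two or more force the whole cut
   into [N], so [k <= delta - 1]. *)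
have [j2|j2] := leqP #|N :&: lset l (Some a0)| 1.
  by move: split_N lek j1 j2; lia.
suff : #|N :&: lset l None| = k by move: split_N lek j1 j2; lia.
rewrite -c0; congr #|pred_of_set _|; apply/setIidPr/subsetP => d; rewrite inE => /eqP ld.
by apply: contraTT j2 => dN; rewrite -leqNgt (full d).
Qed.

(** There are finitely many triples, so some triple in the class maximizes the radius. It is
    extremal, hence isomorphic to the given extremal graph, whose radius is therefore the maximum. A
    graph attaining it is itself extremal. *)
Lemma class_bound l v N (rho rho2 : R) l2 v2 N2 a0 a1 : in_class l v N ->
    is_top (block_graph l v N) rho ->
    extremal k h delta l2 v2 N2 a0 a1 -> is_top (block_graph l2 v2 N2) rho2 ->
  rho <= rho2 /\ (rho = rho2 -> isomorphic (block_graph l v N) (block_graph l2 v2 N2)).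
Proof.
move=> lcl top ex2 top2.
have n0 : (0 < n)%N by apply: leq_ltn_trans (ltn_ord v).
pose T := ({ffun 'I_n -> option 'I_r} * 'I_n * {set 'I_n})%type.
pose graph (t : T) := block_graph t.1.1 t.1.2 t.2.
have ex (t : T) : exists s : R, is_top (graph t) s.
  exact: (is_top_exists R n0 (block_graph_sym _ _ _)).
have [f fP] := choice ex.
pose P (t : T) := `[< in_class t.1.1 t.1.2 t.2 >].
have P0 : P (l, v, N) by apply/asboolP.
have [[[l' v'] N'] /asboolP /= cl' max] := @arg_maxP _ R T (l, v, N) P f P0.
have maxC l0 v0 N0 rho0 : in_class l0 v0 N0 -> is_top (block_graph l0 v0 N0) rho0 ->
    rho0 <= f (l', v', N').
  move=> cl0 top0; rewrite (is_top_uniq top0 (fP (l0, v0, N0))).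
  by apply: max; apply/asboolP.
have top' : is_top (block_graph l' v' N') (f (l', v', N')) := fP (l', v', N').
have [b0 [b1 ex']] := maximal_extremal cl' top' maxC.
have E : f (l', v', N') = rho2.
  apply: is_top_uniq top' _; exact: is_top_iso (extremal_iso ex' ex2) top2.
split; first by rewrite -E; exact: maxC top.
move=> Er; have maxl l0 v0 N0 rho0 : in_class l0 v0 N0 ->
    is_top (block_graph l0 v0 N0) rho0 -> rho0 <= rho.
  by rewrite Er -E; exact: maxC.
have [c0 [c1 exl]] := maximal_extremal lcl top maxl.
exact: extremal_iso exl ex2.
Qed.

(** After [fill_cut], comparing [k] with [delta] decides whether [N] contains the rest of the cut or
    is contained in the cut. *)
Lemma special_in_cut_bound (G : rel 'I_n) l v N (rho1 : R) : symmetric G ->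
    is_top G rho1 -> cut_labelling k h delta l v N -> l v = None ->
    (forall i j, G i j -> block_graph l v N i j) ->
  exists l' N' rho', [/\ in_class l' v N', is_top (block_graph l' v N') rho'
    & rho1 < rho'].
Proof.
move=> sG top lc lv sub.
have n0 : (0 < n)%N by apply: leq_ltn_trans (ltn_ord v).
have [x [x0 xn xE]] := is_top_nonneg sG top.
have le0 := quad_sub x0 sub.
have [l1 [N1 [lc1 lv1 le1 full1]]] := fill_cut r2 x0 lc lv.
have [c0 _ vN1 cN1] := lc1.
have cD : k = #|lset l1 None :\ v|.+1 by rewrite -c0 (cardsD1 v) inE lv1 eqxx.
have [kd|dk] := leqP k delta.
  have cut1 : lset l1 None :\ v \subset N1.
    case: full1 => // N1cut; have : (#|N1| <= #|lset l1 None :\ v|)%N.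
      apply: subset_leq_card; apply/subsetP => i iN; rewrite in_setD1 (subsetP N1cut) //.
      by rewrite andbT; apply: contraNneq vN1 => <-.
    by rewrite cN1; move: kd; rewrite cD; lia.
  have [l2 [N2 [lc2 at2 le2 lt2]]] := special_leaves_cut h1 r2 dkh x0 lc1 lv1 cut1 kd.
  have cl2 : in_class l2 v N2 by split.
  have sB2 := block_graph_sym l2 v N2.
  have [rho2 top2] := is_top_exists R n0 sB2.
  have [le E] := top_step sB2 (in_class_connected cl2) top2 x0 xn xE
    (le_trans le0 (le_trans le1 le2)).
  exists l2, N2, rho2; split=> //; rewrite lt_neqAle le andbT; apply/eqP => /E[xp _ qE].
  have := lt2 xp; rewrite qE ltNge => /negP; apply; exact: le_trans le1.
have N1cut : N1 \subset lset l1 None.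
  case: full1 => // cut1; have /eqP <- : lset l1 None :\ v == N1.
    by rewrite eqEcard cut1 cN1; move: dk; rewrite cD ltnS.
  exact: subsetDl.
have sB1 := block_graph_sym l1 v N1; have [rho' top'] := is_top_exists R n0 sB1.
have /card_gt0P[d dN] : (0 < #|N1|)%N by rewrite cN1.
have ld : l1 d = None by apply/eqP; move: (subsetP N1cut _ dN); rewrite inE.
have dv : d != v by apply: contraNneq vN1 => <-.
have cB1 := block_graph_connected vN1 dv ld dN.
have [le _] := top_step sB1 cB1 top' x0 xn xE (le_trans le0 le1).
(* [x] is an eigenvector of [G] only, while the next exchange needs one of the filled graph. *)
have [y [y0 yn yE]] := is_top_nonneg sB1 top'.
have yp := nonneg_eigen_gt0 cB1 y0 yn yE.
have [l2 [N2 [lc2 at2 lt2]]] := special_leaves_cut_small h1 r2 d1 yp yE lc1 lv1 N1cut.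
have cl2 : in_class l2 v N2 by split.
have sB2 := block_graph_sym l2 v N2; have [rho2 top2] := is_top_exists R n0 sB2.
have [le2 E] := top_step sB2 (in_class_connected cl2) top2 y0 yn yE (ltW lt2).
exists l2, N2, rho2; split=> //; apply: le_lt_trans le _.
rewrite lt_neqAle le2 andbT; apply/eqP => /E[_ _ qE].
by rewrite qE ltxx in lt2.
Qed.

End Comparison.

Theorem theorem1p2 (R : realType) (r h k delta n : nat) (G : rel 'I_n) :
  2 <= r -> 1 <= h -> 1 <= k -> 1 <= delta -> k + r * h.+1 <= n ->
  simple_graph G -> kappa_hr_is G r h k -> min_degree_is G delta ->
  forall rho1 rho2 : R,
    is_spectral_radius (adjmx R G) rho1 ->
    is_spectral_radius (adjmx R (Gext n k r h delta)) rho2 ->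
    (rho1 <= rho2)%R /\ (rho1 = rho2 <-> isomorphic G (Gext n k r h delta)).
Proof.
move=> r2 h01 k1 d1 kn sG [[S [Scut cS]] _] [[v dv] dmin] rho1 rho2.
set h' := maxn h (delta - k).
have [l [lc sub lv]] := cut_embedding h01 (ltnW r2) sG Scut cS dv dmin.
(* The labelling of [G] itself provides [r] blocks with more than [h'] vertices each, besides the
   cut. *)
have kn' : k + r * h'.+1 <= n.
  rewrite [in X in _ <= X](card_labels l); have [-> ca _ _] := lc.
  rewrite leq_add2l -{1}(card_ord r) -sum_nat_const; apply: leq_sum => a _; exact: ca.
have n0 : 0 < n by apply: leq_trans kn; rewrite addn_gt0 k1.
have h1' : 0 < h' by rewrite /h' leq_max h01.
have dkh : delta <= k + h' by rewrite /h'; lia.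
have GE : Gext n k r h delta =
    block_graph (Gext_label n k h delta r2) (Gext_special r2 h01 k1 d1 kn')
      (Gext_nbhd n r k h delta).
  by apply/funext => i; apply/funext => j; rewrite (GextE r2 h01 k1 d1 kn').
rewrite GE => rad1 rad2; have [a0 [a1 ex2]] := Gext_extremal r2 h01 k1 d1 kn'.
have top1 := spectral_radius_top n0 sG.1 rad1.
have top2 := spectral_radius_top n0 (block_graph_sym _ _ _) rad2.
suff [le iso] : (rho1 <= rho2)%R /\ (rho1 = rho2 -> isomorphic G
    (block_graph (Gext_label n k h delta r2) (Gext_special r2 h01 k1 d1 kn')
      (Gext_nbhd n r k h delta))).
  by split=> //; split=> [|/is_top_iso /(_ top2)]; [exact: iso|exact: is_top_uniq].
case: lv => [lv|lat].
  have [l' [N' [rho' [cl' top' lt]]]] :=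
    special_in_cut_bound k1 h1' r2 d1 dkh sG.1 top1 lc lv sub.
  have [le _] := class_bound k1 h1' r2 d1 dkh cl' top' ex2 top2.
  have lt2 := lt_le_trans lt le; split; first exact: ltW.
  by move=> E; rewrite E ltxx in lt2.
have cl := conj lc lat; have sB := block_graph_sym l v [set u | G v u].
have [x [x0 xn xE]] := is_top_nonneg sG.1 top1.
have [rho' top'] := is_top_exists R n0 sB.
have [le E] := top_step sB (in_class_connected k1 cl) top' x0 xn xE (quad_sub x0 sub).
have [le' iso] := class_bound k1 h1' r2 d1 dkh cl top' ex2 top2.
split; first exact: le_trans le le'.
(* Equality holds in both comparisons: equal neighbour sums at a positive vector identify [G] with
   its completion, and [class_bound] identifies the latter with the extremal graph. *)
move=> E12; have E1 : rho1 = rho' by apply/eqP; rewrite eq_le le E12 le'.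
have [xp nbE _] := E E1.
have -> : G = block_graph l v [set u | G v u].
  by apply/funext => i; apply/funext => j; exact: nbsum_sub_eq xp sub (nbE i) j.
by apply: iso; rewrite -E1.
Qed.
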